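(* Let $d\ge 1$ and let $F,G$ be probability distributions on $\mathbb{R}^d$ which admit bounded densities $f,g\colon\mathbb{R}^d\to\mathbb{R}$ with respect to the Lebesgue measure. Suppose that the expected Euler characteristic curves satisfy $\overline{\chi}_F(\Lambda)=\overline{\chi}_G(\Lambda)$ for all $\Lambda\ge 0$, and that this common function is $d$ times differentiable in $0$ (right-sided derivatives). Then the excess mass transforms agree: $\hat f=\hat g$.
   Context: Čech complex: for a finite set $X\subset\mathbb{R}^d$ and $r\ge 0$, $\mathcal{C}_r(X)$ is the simplicial complex with vertex set $X$ in which a nonempty subset $\sigma\subseteq X$ is a simplex iff $\bigcap_{x\in\sigma}\overline{B}_r(x)\neq\emptyset$ (closed Euclidean balls). Its Euler characteristic is $\chi(\mathcal{C}_r(X))=\sum_{\sigma\in\mathcal{C}_r(X)}(-1)^{|\sigma|-1}$. Expected Euler characteristic curve (EECC): let $F$ be a probability distribution on $\mathbb{R}^d$ with bounded density $f$. Let $X_n$ be either $n$ i.i.d. samples from $F$ (Bernoulli setting) or a Poisson point process of intensity $nf$ (Poisson setting). Let $\omega_d$ be the volume of the unit ball in $\mathbb{R}^d$. Define $\overline{\chi}_F\colon[0,\infty[\to\mathbb{R}$ by $\overline{\chi}_F(0)=1$ and, for $\Lambda>0$, $\overline{\chi}_F(\Lambda)=\lim_{n\to\infty}n^{-1}\mathbb{E}[\chi(\mathcal{C}_{r_n}(X_n))]$, where $(r_n)_n$ is a sequence of positive radii with $n\omega_d r_n^d\to\Lambda$ as $n\to\infty$ (thermodynamic limit). It is known that this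 limit exists. Excess mass transform of a probability density $f$ on $\mathbb{R}^d$: $\hat f(t)=\int_{\mathbb{R}^d}\mathbbm{1}_{[t,\infty[}(f(x))\,f(x)\,\mathrm{d}x$ for $t\ge 0$. *)

(* Defs.v *)
From HB Require Import structures.
From mathcomp Require Import all_boot all_order all_algebra finmap.
From mathcomp Require Import all_classical all_reals all_analysis.
Set Implicit Arguments.
Unset Strict Implicit.
Unset Printing Implicit Defensive.
Import Order.TTheory GRing.Theory Num.Theory numFieldNormedType.Exports.
Local Open Scope classical_set_scope.
Local Open Scope ring_scope.

Section tuple_measure.
Context {dsp : measure_display} {T : measurableType dsp} {R : realType}.
Variable mu : {sigma_finite_measure set T -> \bar R}.

Definition tuple_cons n (p : T * n.-tuple T) : n.+1.-tuple T :=
  [tuple of p.1 :: p.2].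

Lemma measurable_tuple_cons n : measurable_fun setT (@tuple_cons n).
Proof. exact: (measurable_cons measurable_fst measurable_snd). Qed.

Section cons_measure.
Variables (n : nat) (nu : {sigma_finite_measure set (n.-tuple T) -> \bar R}).

Definition cons_measure : set (n.+1.-tuple T) -> \bar R :=
  pushforward (mu \x nu)%E (@tuple_cons n).

Let cons_measure0 : cons_measure set0 = 0%E.
Proof. by rewrite /cons_measure /pushforward preimage_set0; exact: measure0. Qed.

Let cons_measure_ge0 A : (0 <= cons_measure A)%E.
Proof. exact: (measure_ge0 (mu \x nu)%E). Qed.

Let cons_measure_sigma_additive : semi_sigma_additive cons_measure.
Proof.
move=> F mF tF mUF; rewrite /cons_measure /pushforward preimage_bigcup.
have mpre A : measurable A -> measurable (@tuple_cons n @^-1` A).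
  by move=> mA; rewrite -[X in measurable X]setTI; exact: measurable_tuple_cons.
apply: measure_semi_sigma_additive.
- by move=> k; exact: mpre.
- apply/trivIsetP => /= i j _ _ ij; rewrite -preimage_setI.
  by move/trivIsetP : tF => /(_ _ _ _ _ ij) ->//; rewrite preimage_set0.
- by rewrite -preimage_bigcup; exact: mpre.
Qed.

HB.instance Definition _ := isMeasure.Build _ _ _ cons_measure
  cons_measure0 cons_measure_ge0 cons_measure_sigma_additive.

Let cons_measure_sigma_finite : sigma_finite setT cons_measure.
Proof.
have /sigma_finiteP[F [TF ndF Foo]] := sigma_finiteT mu.
have /sigma_finiteP[G [TG ndG Goo]] := sigma_finiteT nu.
pose uncons (t : n.+1.-tuple T) := (thead t, [tuple of behead t]).
have consK : cancel (@tuple_cons n) uncons.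
  by move=> [x t]; rewrite /uncons theadE; congr pair; exact: val_inj.
have unconsK : cancel uncons (@tuple_cons n).
  by move=> t; rewrite [RHS]tuple_eta; exact: val_inj.
have muncons : measurable_fun setT uncons.
  apply/measurable_fun_pairP; split; first exact: measurable_tnth.
  exact: measurable_behead.
exists (fun k => uncons @^-1` (F k `*` G k)).
  apply/esym; rewrite -subTset => t _.
  have [i _ Fi] : (\bigcup_i F i) (uncons t).1 by rewrite -TF.
  have [j _ Gj] : (\bigcup_i G i) (uncons t).2 by rewrite -TG.
  exists (maxn i j) => //; split.
    by move: Fi; exact/subsetPset/ndF/leq_maxl.
  by move: Gj; exact/subsetPset/ndG/leq_maxr.
move=> k; have [? ?] := Foo k; have [? ?] := Goo k; split.
  by rewrite -[X in measurable X]setTI; apply: muncons => //; exact: measurableX.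
rewrite /cons_measure /pushforward -comp_preimage.
rewrite (_ : uncons \o _ = id) ?preimage_id; last first.
  by apply/funext => p; exact: consK.
by rewrite product_measure1E// lte_mul_pinfty// ge0_fin_numE.
Qed.

HB.instance Definition _ := Measure_isSigmaFinite.Build _ _ _ cons_measure
  cons_measure_sigma_finite.

End cons_measure.

Fixpoint tuple_measure n : {sigma_finite_measure set (n.-tuple T) -> \bar R} :=
  if n is n'.+1 then cons_measure (tuple_measure n') else \d_([tuple]).

End tuple_measure.

(* The carrier of R^d, with the product of the Borel sigma-algebras; the library
   puts [lebesgue_measure] on [measurableTypeR R], which is convertible to R. *)
Notation euclid R d := (d.-tuple (measurableTypeR R)).

Section euclidean_space.
Context {R : realType} {d : nat}.
Implicit Types (x y : euclid R d) (X : {fset euclid R d}).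

Definition lebesgue_tuple : {sigma_finite_measure set (euclid R d) -> \bar R} :=
  tuple_measure (@lebesgue_measure R) d.

Definition eucl_dist x y : R :=
  Num.sqrt (\sum_(i < d) ((tnth x i : R) - tnth y i) ^+ 2).

Definition eucl_cball x (r : R) : set (euclid R d) :=
  [set y | eucl_dist x y <= r].

Definition unit_ball_volume : R :=
  fine (lebesgue_tuple (eucl_cball [tuple (0 : R) | i < d] 1)).

Definition cech_complex (r : R) X : {fset {fset euclid R d}} :=
  [fset s in fpowerset X | (s != fset0) &&
    `[< \bigcap_(x in [set` s]) eucl_cball x r !=set0 >] ]%fset.

Definition euler_char (K : {fset {fset euclid R d}}) : R :=
  \sum_(s <- K) (-1) ^+ (#|` s|.-1).

Definition bounded_density (F : probability (euclid R d) R)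
    (f : euclid R d -> R) : Prop :=
  [/\ measurable_fun setT f,
      forall x, 0 <= f x,
      exists M, forall x, f x <= M &
      forall A, measurable A -> F A = (\int[lebesgue_tuple]_(x in A) (f x)%:E)%E].

Definition excess_mass (f : euclid R d -> R) (t : R) : R :=
  \int[lebesgue_tuple]_x (\1_(`[t, +oo[) (f x) * f x).

End euclidean_space.

Variant sampling := BernoulliSampling | PoissonSampling.

Section eecc.
Context {R : realType} {d : nat}.
Variables (S : sampling) (F : probability (euclid R d) R).

Definition iid_mean_euler_char (n : nat) (r : R) : R :=
  \int[tuple_measure F n]_x
    euler_char (cech_complex r [fset y in (x : seq (euclid R d))]%fset).

(* A Poisson process with the finite intensity measure n F is a sample of N
   i.i.d. points of law F, where N is an independent Poisson(n) variable.
   The last argument of [poisson_prob] is a dummy. *)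
Definition mean_euler_char (n : nat) (r : R) : R :=
  match S with
  | BernoulliSampling => iid_mean_euler_char n r
  | PoissonSampling =>
      \int[poisson_prob n%:R 0]_k iid_mean_euler_char k r
  end.

Definition thermodynamic (L : R) (r : nat -> R) : Prop :=
  (forall n, 0 < r n) /\
  n%:R * unit_ball_volume (d := d) * r n ^+ d @[n --> \oo] --> L.

(* For L > 0 the set below is a singleton; [get] selects its element. *)
Definition eecc (L : R) : R :=
  if L == 0 then 1 else
  get [set l : R | forall r : nat -> R, thermodynamic L r ->
    n%:R^-1 * mean_euler_char n (r n) @[n --> \oo] --> l].

End eecc.

Section halfline_derivative.
Context {R : realType}.
Implicit Types (h : R -> R) (x : R).

(* Functions on [0, +oo[ are represented by total functions; the limits below
   only see nonnegative points, so they are right-sided at 0. *)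
Definition halfline_quotient h x : set_system R :=
  (h y - h x) / (y - x) @[y --> within `[0, +oo[ x^'].

Definition halfline_derivable h x : Prop := cvg (halfline_quotient h x).

Definition halfline_derive h x : R := lim (halfline_quotient h x).

Definition times_derivable_at0 (k : nat) h : Prop :=
  forall j, (j < k)%N ->
    let hj := iter j halfline_derive h in
    halfline_derivable hj 0 /\
    ((j.+1 < k)%N -> \forall x \near 0^'+, halfline_derivable hj x).

End halfline_derivative.

(* Main.v *)
Require Import Defs.
From mathcomp Require Import all_boot all_order all_algebra finmap.
From mathcomp Require Import all_classical all_reals all_analysis.
From mathcomp Require Import measurable_realfun.
From mathcomp Require Import ring lra.
Set Implicit Arguments.
Unset Strict Implicit.
Unset Printing Implicit Defensive.
Import Order.TTheory GRing.Theory Num.Theory numFieldNormedType.Exports.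
Local Open Scope classical_set_scope.
Local Open Scope ring_scope.

(**
For [L > 0] the expected Euler characteristic curve is the sum of a power series
that converges everywhere,
  [eecc S F L = \sum_j a_j * m_j * L ^ j], where [m_j = \int[F]_x f x ^ j]
are the moments of the density under its own law and the numbers [a_j] depend
only on [d] and are all nonzero ([eecc_series], [eecc_coef_neq0]).  Two
densities with the same curve therefore have the same moments
([power_series_eq0]), i.e. the bounded random variables [f] under [F] and [g]
under [G] have the same law, and [excess_mass f t] is the probability that [f]
is at least [t].

The series comes from counting simplices.  The Euler characteristic is an
alternating sum over the subsamples whose balls meet ([euler_char_cech]), so its
mean over [n] points is the sum over [j] of [(-1) ^ j * 'C(n, j.+1)] times
the probability [simplex_prob j r] that [j.+1] independent points span a simplex
([iid_mean_euler_charE]); a Poisson number of points turns the binomial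
coefficient into [n ^ j.+1 / j.+1`!] ([poisson_binomial_series]).  For large [n]
the two coefficients are equivalent, which is why both ways of sampling lead to
the same curve.

To find the probability of a simplex at a small scale [r], put the origin at one
of its points and divide all lengths by [r].  The Jacobian is [r ^ (d * j)], the
condition on the other [j] points [t] becomes that the unit balls around the
origin and around the points of [t] meet, and the density at the point
[x + r * t_i] tends to [f x].  Hence
  [simplex_prob j r / r ^ (d * j) --> cech_volume d j * m_j]
where [cech_volume d j] is the volume of the set of such [t]
([simplex_prob_cvg]).  As [f] need not be continuous, the last convergence is
taken in the mean with respect to [F] ([translates_cvg]).  The same computation
bounds [simplex_prob j r] by [(C * r ^ d) ^ j], so that when [n * r ^ d] remains
bounded the [j]-th term of the alternating sum, divided by [n], is at most
[B ^ j / j`!], and the limit may be taken term by term ([tannery]).  The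
coefficient [a_j] is nonzero because [cech_volume d j] is: all points close to
the origin qualify.

To pass from moments to excess mass explicitly, the indicator of [f x < t] is
the bounded pointwise limit of polynomials in [f x] ([threshold_poly_cvg],
[excess_mass_limit]).
*)

(** * Product measures on tuples *)

Section tuple_integral.
Local Open Scope ereal_scope.
Context {dsp : measure_display} {T : measurableType dsp} {R : realType}.

Lemma ge0_integral_tuple0 (mu : {sigma_finite_measure set T -> \bar R})
    (h : 0.-tuple T -> \bar R) :
  (forall t, 0 <= h t) ->
  @integral _ _ _ (tuple_measure mu 0) setT h = h ([tuple] : 0.-tuple T).
Proof.
move=> h0; rewrite (_ : h = cst (h [tuple])); last first.
  by apply/funext => t; rewrite tuple0.
by rewrite integral_cst//= diracE in_setT mule1.
Qed.

Lemma measurable_tuple_cons_section n (h : n.+1.-tuple T -> \bar R) x :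
  measurable_fun setT h ->
  measurable_fun setT (fun s => h (tuple_cons (x, s))).
Proof.
move=> mh; apply: measurableT_comp => //.
by apply: measurableT_comp; [exact: measurable_tuple_cons|exact: pair1_measurable].
Qed.

Lemma ge0_integral_tupleS (mu : {sigma_finite_measure set T -> \bar R}) n
    (h : n.+1.-tuple T -> \bar R) :
  measurable_fun setT h -> (forall t, 0 <= h t) ->
  \int[tuple_measure mu n.+1]_t h t =
  \int[mu]_x \int[tuple_measure mu n]_s h (tuple_cons (x, s)).
Proof.
move=> mh h0 /=.
rewrite (@ge0_integral_pushforward _ _ _ _ _ _ (@measurable_tuple_cons _ _ n)
  (mu \x tuple_measure mu n) setT h)//=.
rewrite preimage_setT fubini_tonelli1//.
by apply: measurableT_comp => //; exact: measurable_tuple_cons.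
Qed.

Lemma measurable_integral_tuple_cons (mu : {sigma_finite_measure set T -> \bar R})
    n (h : n.+1.-tuple T -> \bar R) :
  measurable_fun setT h -> (forall t, 0 <= h t) ->
  measurable_fun setT
    (fun x => \int[tuple_measure mu n]_s h (tuple_cons (x, s))).
Proof.
move=> mh h0.
apply: (measurable_fun_fubini_tonelli_F (fun z => h (tuple_cons z))) => //.
by apply: measurableT_comp => //; exact: measurable_tuple_cons.
Qed.

Lemma tnth_tuple_consS n (x : T) (s : n.-tuple T) i :
  tnth (tuple_cons (x, s)) (lift ord0 i) = tnth s i.
Proof. exact: tnthS. Qed.

Lemma measurable_map_coords n (phi : 'I_n -> T -> T) :
  (forall i, measurable_fun setT (phi i)) ->
  measurable_fun setT (fun t : n.-tuple T => [tuple phi i (tnth t i) | i < n]).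
Proof.
move=> mphi; apply/measurable_fun_tnthP => i.
rewrite (_ : _ \o _ = fun t => phi i (tnth t i)); last first.
  by apply/funext => t /=; rewrite tnth_mktuple.
by apply: measurableT_comp => //; exact: measurable_tnth.
Qed.

(** Tonelli, one coordinate at a time. *)
Lemma tuple_measure_change_of_variables
    (mu nu : {sigma_finite_measure set T -> \bar R}) n
    (w : 'I_n -> T -> R) (phi : 'I_n -> T -> T) :
  (forall i, measurable_fun setT (w i)) -> (forall i x, (0 <= w i x)%R) ->
  (forall i, measurable_fun setT (phi i)) ->
  (forall i (h : T -> \bar R), measurable_fun setT h -> (forall x, 0 <= h x) ->
    \int[nu]_x h x = \int[mu]_x ((w i x)%:E * h (phi i x))) ->
  forall h : n.-tuple T -> \bar R,
  measurable_fun setT h -> (forall t, 0 <= h t) ->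
  \int[tuple_measure nu n]_t h t =
  \int[tuple_measure mu n]_t ((\prod_(i < n) w i (tnth t i))%:E *
     h [tuple phi i (tnth t i) | i < n]).
Proof.
elim: n w phi => [|n IH] w phi mw w0 mphi numu h mh h0.
  rewrite !ge0_integral_tuple0//; last first.
    by move=> t; rewrite mule_ge0// lee_fin prodr_ge0.
  by rewrite big_ord0 mul1e; congr h; apply/val_inj; rewrite (tuple0 [tuple _ | _ < _]).
have mW : measurable_fun setT (fun t : n.+1.-tuple T => (\prod_(i < n.+1) w i (tnth t i))%R).
  apply: measurable_prod => i _.
  by apply: measurableT_comp => //; exact: measurable_tnth.
have mP := measurable_map_coords mphi.
have W0 t : 0 <= (\prod_(i < n.+1) w i (tnth t i))%:E.
  by rewrite lee_fin prodr_ge0.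
rewrite [RHS]ge0_integral_tupleS//; last 2 first.
- apply: emeasurable_funM; first exact/measurable_EFinP.
  exact: measurableT_comp.
- by move=> t; rewrite mule_ge0.
rewrite ge0_integral_tupleS// (numu ord0); last 2 first.
- exact: measurable_integral_tuple_cons.
- by move=> x; exact: integral_ge0.
apply: eq_integral => x _.
have mhc : measurable_fun setT (fun s => h (tuple_cons (phi ord0 x, s))).
  exact: measurable_tuple_cons_section.
rewrite (IH (fun i => w (lift ord0 i)) (fun i => phi (lift ord0 i)))//; last first.
  by move=> i; exact: numu.
rewrite -ge0_integralZl//; last 3 first.
- apply: emeasurable_funM.
    apply/measurable_EFinP; apply: measurable_prod => i _.
    by apply: measurableT_comp => //; exact: measurable_tnth.
  apply: (measurableT_comp mhc).
  exact: (measurable_map_coords (fun i => mphi (lift ord0 i))).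
- by move=> s _; rewrite mule_ge0// lee_fin prodr_ge0.
- by rewrite lee_fin.
apply: eq_integral => s _; rewrite muleA -EFinM big_ord_recl.
congr (_%:E * h _).
  by congr (_ * _)%R; apply: eq_bigr => i _; rewrite tnth_tuple_consS.
apply/eq_from_tnth => i; rewrite tnth_mktuple.
have [->|] := eqVneq i ord0; first by [].
move=> i0; have [j ->] : exists j, i = lift ord0 j.
  by case: (unliftP ord0 i) i0 => [j ->|->]; [exists j|rewrite eqxx].
by rewrite !tnth_tuple_consS tnth_mktuple.
Qed.

Lemma measurable_tuple_box n (B : 'I_n -> set T) :
  (forall i, measurable (B i)) ->
  measurable [set t : n.-tuple T | forall i, B i (tnth t i)].
Proof.
move=> mB.
rewrite (_ : [set t | _] =
    \bigcap_(i in [set: 'I_n]) ((fun t : n.-tuple T => tnth t i) @^-1` B i)).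
  apply: fin_bigcap_measurable => // i _; rewrite -[X in measurable X]setTI.
  exact: (measurable_tnth i).
by apply/seteqP; split => t /= Bt i; [move=> _; exact: Bt|exact: Bt].
Qed.

Lemma tuple_measure_box (mu : {sigma_finite_measure set T -> \bar R}) n
    (B : 'I_n -> set T) :
  (forall i, measurable (B i)) ->
  tuple_measure mu n [set t | forall i, B i (tnth t i)] = \prod_(i < n) mu (B i).
Proof.
elim: n B => [|n IH] B mB.
  by rewrite big_ord0 /= diracE mem_set// => -[].
rewrite -(setIT [set t | _]) -integral_indic//; last exact: measurable_tuple_box.
rewrite ge0_integral_tupleS//; last first.
  by apply/measurable_EFinP; apply: measurable_indic; exact: measurable_tuple_box.
have mtail : measurable_fun setT (fun s : n.-tuple T =>
    (\1_[set t : n.-tuple T | forall i, B (lift ord0 i) (tnth t i)] s : R)%:E).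
  apply/measurable_EFinP; apply: measurable_indic.
  by apply: (measurable_tuple_box (B := fun i => B (lift ord0 i))) => i.
have tailE : \int[tuple_measure mu n]_s
    (\1_[set t : n.-tuple T | forall i, B (lift ord0 i) (tnth t i)] s)%:E =
    \prod_(i < n) mu (B (lift ord0 i)).
  rewrite integral_indic//; last first.
    by apply: (measurable_tuple_box (B := fun i => B (lift ord0 i))) => i.
  by rewrite setIT -(IH (fun i => B (lift ord0 i))).
under eq_integral => x _.
  under eq_integral => s _.
    rewrite (_ : \1_ _ _ = \1_(B ord0) x *
       \1_[set t : n.-tuple T | forall i, B (lift ord0 i) (tnth t i)] s)%R; last first.
      rewrite !indicE -natrM mulnb; congr (_%:R); congr nat_of_bool.
      apply/idP/andP; rewrite !inE /=.
        move=> Bt; split; first by have := Bt ord0.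
        by move=> i; have := Bt (lift ord0 i); rewrite tnth_tuple_consS.
      move=> [B0 Bs] i; have [->|] := eqVneq i ord0; first by [].
      case: (unliftP ord0 i) => [j ->|->]; last by rewrite eqxx.
      by rewrite tnth_tuple_consS.
    rewrite EFinM; over.
  rewrite ge0_integralZl//=.
  rewrite tailE; over.
rewrite /= ge0_integralZr//; last 2 first.
- by apply/measurable_EFinP; exact: measurable_indic.
- by apply: prode_ge0.
by rewrite integral_indic// setIT big_ord_recl.
Qed.

Lemma tuple_measure_setT (mu : {sigma_finite_measure set T -> \bar R}) n :
  mu setT = 1 -> tuple_measure mu n setT = 1.
Proof.
move=> mu1; rewrite (_ : setT = [set t : n.-tuple T | forall i, setT (tnth t i)]).
  by rewrite (tuple_measure_box _ (B := fun=> setT))// big1.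
by apply/seteqP; split.
Qed.

End tuple_integral.

(** * Changes of variables in Euclidean space *)

Section affine.
Local Open Scope ereal_scope.
Context {R : realType}.

Let affine (x r : R) : measurableTypeR R -> measurableTypeR R := fun u => (x + r * u)%R.

Lemma measurable_affine (x r : R) : measurable_fun setT (affine x r).
Proof. by apply: measurable_funD => //; exact: measurable_funM. Qed.

Lemma lebesgue_measure_affine (x r : R) (A : set (measurableTypeR R)) :
  (0 < r)%R -> measurable A ->
  lebesgue_measure A = r%:E * lebesgue_measure (affine x r @^-1` A).
Proof.
move=> r0 mA.
apply: (lebesgue_measure_unique (mu := mscale (NngNum (ltW r0))
  (pushforward lebesgue_measure (affine x r)))) => //=.
  exact: measurable_affine.
move=> maffine _ [[a b]] _ <-; rewrite /mscale /= /pushforward.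
rewrite (_ : _ @^-1` _ = `]((a - x) / r)%R, ((b - x) / r)%R]%classic); last first.
  apply/seteqP; split => u /=; rewrite !in_itv/= /affine ltr_pdivrMr// ler_pdivlMr//;
  by rewrite mulrC ltrBlDl lerBrDl.
rewrite !lebesgue_measure_itv/= !lte_fin ltr_pM2r ?invr_gt0// ltrD2r.
case: ifPn => _; last by rewrite mule0.
rewrite -!EFinD -EFinM; congr (_%:E); field.
by rewrite gt_eqF.
Qed.

Lemma lebesgue_integral_affine (x r : R) (h : measurableTypeR R -> \bar R) :
  (0 < r)%R -> measurable_fun setT h -> (forall u, 0 <= h u) ->
  \int[lebesgue_measure]_u h u =
  \int[lebesgue_measure]_u (r%:E * h (x + r * u)%R).
Proof.
move=> r0 mh h0.
rewrite ge0_integralZl//; last 2 first.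
- by apply: (measurableT_comp mh); exact: measurable_affine.
- by rewrite lee_fin ltW.
rewrite -[in RHS](preimage_setT (affine x r)).
rewrite -(ge0_integral_pushforward (measurable_affine x r) lebesgue_measure)//.
rewrite (_ : r%:E = (NngNum (ltW r0))%:num%:E)// -ge0_integral_mscale//.
  exact: measurable_affine.
move=> maffine; apply: eq_measure_integral => A mA _ /=.
by rewrite /mscale/= -lebesgue_measure_affine.
Qed.

End affine.

Section density.
Local Open Scope ereal_scope.
Context {dsp : measure_display} {T : measurableType dsp} {R : realType}.
Import HBNNSimple.

(** The class of functions for which the formula holds contains the indicators
    and is closed under sums and monotone limits. *)
Lemma ge0_integral_density (mu nu : {measure set T -> \bar R}) (f : T -> R)
    (h : T -> \bar R) :
  measurable_fun setT f -> (forall x, (0 <= f x)%R) ->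
  (forall A, measurable A -> nu A = \int[mu]_(x in A) (f x)%:E) ->
  measurable_fun setT h -> (forall x, 0 <= h x) ->
  \int[nu]_x h x = \int[mu]_x ((f x)%:E * h x).
Proof.
move=> mf f0 nuE mh h0.
have mfE : measurable_fun setT (EFin \o f) by exact/measurable_EFinP.
pose g := nnsfun_approx measurableT mh.
have hE x : h x = limn (fun n => (g n x)%:E).
  by apply/esym/cvg_lim => //; exact: cvg_nnsfun_approx.
have -> : \int[nu]_x h x = limn (fun n => \int[nu]_x (g n x)%:E).
  rewrite -monotone_convergence//=.
  - by apply: eq_integral => x _; exact: hE.
  - by move=> n; exact/measurable_EFinP.
  - by move=> n x _; rewrite lee_fin.
  - by move=> x _ a b ab; rewrite lee_fin; exact/lefP/nd_nnsfun_approx.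
have -> : \int[mu]_x ((f x)%:E * h x) =
    limn (fun n => \int[mu]_x ((f x)%:E * (g n x)%:E)).
  rewrite -monotone_convergence//=.
  - apply: eq_integral => x _; apply/esym/cvg_lim => //.
    by apply: cvgeZl => //; exact: cvg_nnsfun_approx.
  - by move=> n; apply: emeasurable_funM => //; exact/measurable_EFinP.
  - by move=> n x _; rewrite mule_ge0// lee_fin.
  - move=> x _ a b ab; rewrite lee_wpmul2l ?lee_fin//.
    exact/lefP/nd_nnsfun_approx.
congr (limn _); apply/funext => n.
under eq_integral do rewrite fimfunE -fsumEFin//.
rewrite ge0_integral_fsum//; last 2 first.
- by move=> y; exact/measurable_EFinP/measurable_funM.
- by move=> y x _; rewrite nnfun_muleindic_ge0.
under [RHS]eq_integral => x _.
  rewrite fimfunE -fsumEFin// ge0_mule_fsumr//; last first.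
    by move=> y; exact: nnfun_muleindic_ge0.
  over.
rewrite [RHS]ge0_integral_fsum//; last 2 first.
- move=> y; apply: emeasurable_funM => //.
  exact/measurable_EFinP/measurable_funM.
- move=> y x _; rewrite mule_ge0 ?lee_fin//.
  exact: nnfun_muleindic_ge0.
apply: eq_fsbigr => y; rewrite inE => -[z _ <-{y}].
rewrite integralZl_indic_nnsfun// integral_indic// setIT nuE//.
under [RHS]eq_integral do rewrite EFinM muleCA.
rewrite ge0_integralZl//; last 3 first.
- by apply: emeasurable_funM => //; apply/measurable_EFinP.
- by move=> x _; rewrite mule_ge0// lee_fin.
- by rewrite lee_fin.
congr (_ * _); rewrite integral_mkcond; apply: eq_integral => x _.
by rewrite epatch_indic.
Qed.

End density.

Section euclidean_change_of_variables.
Local Open Scope ereal_scope.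
Context {R : realType} {d : nat}.

Definition homothety (x : euclid R d) (r : R) (y : euclid R d) : euclid R d :=
  [tuple ((tnth x i : R) + r * tnth y i)%R | i < d].

Lemma measurable_homothety x r : measurable_fun setT (homothety x r).
Proof.
apply: (measurable_map_coords (phi := fun i u => (tnth x i : R) + r * u)%R) => i.
exact: measurable_affine.
Qed.

Lemma lebesgue_tuple_homothety (x : euclid R d) (r : R)
    (h : euclid R d -> \bar R) :
  (0 < r)%R -> measurable_fun setT h -> (forall y, 0 <= h y) ->
  \int[lebesgue_tuple]_y h y =
  \int[lebesgue_tuple]_y ((r ^+ d)%:E * h (homothety x r y)).
Proof.
move=> r0 mh h0.
rewrite [LHS](tuple_measure_change_of_variables (mu := lebesgue_measure)
  (w := fun=> cst r) (phi := fun i u => (tnth x i : R) + r * u)%R)//.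
- by under eq_integral do rewrite prodr_const card_ord.
- by move=> i u; exact: ltW.
- by move=> i; exact: measurable_affine.
- by move=> i k mk k0; exact: lebesgue_integral_affine.
Qed.

Lemma bounded_density_homothety (F : probability (euclid R d) R)
    (f : euclid R d -> R) (x : euclid R d) (r : R) (h : euclid R d -> \bar R) :
  bounded_density F f -> (0 < r)%R ->
  measurable_fun setT h -> (forall y, 0 <= h y) ->
  \int[F]_y h y =
  \int[lebesgue_tuple]_y ((r ^+ d * f (homothety x r y))%:E *
                          h (homothety x r y)).
Proof.
move=> [mf f0 _ FE] r0 mh h0.
rewrite (ge0_integral_density (f := f) (mu := lebesgue_tuple))//.
rewrite [LHS](lebesgue_tuple_homothety x r0)//.
- by apply: eq_integral => y _; rewrite EFinM muleA.
- by apply: emeasurable_funM => //; exact/measurable_EFinP.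
- by move=> y; rewrite mule_ge0// lee_fin.
Qed.

(** Coordinates centred at [x] with unit of length [r], for all points of a sample
    simultaneously; this is what makes the limit of small radii visible. *)
Lemma sample_homothety (F : probability (euclid R d) R) (f : euclid R d -> R)
    (x : euclid R d) (r : R) n (h : n.-tuple (euclid R d) -> \bar R) :
  bounded_density F f -> (0 < r)%R ->
  measurable_fun setT h -> (forall y, 0 <= h y) ->
  \int[tuple_measure F n]_t h t =
  \int[tuple_measure lebesgue_tuple n]_t
    ((\prod_(i < n) (r ^+ d * f (homothety x r (tnth t i))))%:E *
     h [tuple homothety x r (tnth t i) | i < n]).
Proof.
move=> Ff r0 mh h0; have [mf f0 _ _] := Ff.
rewrite [LHS](tuple_measure_change_of_variables (mu := lebesgue_tuple)
  (w := fun=> fun y => (r ^+ d * f (homothety x r y))%R)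
  (phi := fun=> homothety x r))//.
- move=> i; apply: measurable_funM => //.
  exact: (measurableT_comp mf (measurable_homothety x r)).
- by move=> i y; rewrite mulr_ge0// exprn_ge0// ltW.
- by move=> i; exact: measurable_homothety.
- by move=> i k mk k0; exact: bounded_density_homothety.
Qed.

End euclidean_change_of_variables.

(** * Alternating sums over subsamples *)

Section masks.
Context {R : realType}.

(** A mask is a set of positions in a sample rather than a set of points.
    Positions can be summed over and integrated without any case distinction
    on whether the points of the sample coincide. *)
Fixpoint masks n : seq bitseq :=
  if n is n'.+1 then map (cons false) (masks n') ++ map (cons true) (masks n')
  else [:: [::]].

Lemma size_masks n m : m \in masks n -> size m = n.
Proof.
elim: n m => [|n IH] m /=; first by rewrite inE => /eqP ->.
by rewrite mem_cat => /orP[|] /mapP[m' /IH <- ->].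
Qed.

(** A sum over masks of a function of their weight is a binomial sum; by
    independence the mean of a sum over subsamples has this form. *)
Lemma sum_masks n (q : nat -> R) :
  \sum_(m <- masks n) (-1) ^+ count id m * q (count id m) =
  \sum_(k < n.+1) (-1) ^+ k * 'C(n, k)%:R * q k.
Proof.
elim: n q => [|n IH] q.
  by rewrite /= big_seq1 big_ord_recl big_ord0 /= bin0 addr0 mulr1.
rewrite /= big_cat/= !big_map/= IH.
under [X in _ + X]eq_bigr do rewrite exprS mulN1r mulNr.
rewrite sumrN (IH (q \o S)).
rewrite big_ord_recl [in RHS]big_ord_recl/= !bin0 -addrA; congr (_ + _).
under [in RHS]eq_bigr => i _ do
  rewrite /bump/= !add1n binS natrD mulrDr mulrDl.
rewrite big_split/=; congr (_ + _).
  by rewrite [in RHS]big_ord_recr/= bin_small// mulr0 mul0r addr0.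
by rewrite -sumrN; apply: eq_bigr => i _; rewrite exprS !mulN1r !mulNr.
Qed.

End masks.

Section inclusion_exclusion.
Context {R : realType} {T : choiceType}.
Implicit Types (X : {fset T}) (Q : {fset T} -> R).
Local Open Scope fset_scope.

Lemma perm_fpowersetU1 x X : x \notin X ->
  perm_eq (fpowerset (x |` X)) (fpowerset X ++ map (fun s => x |` s) (fpowerset X)).
Proof.
move=> xX; apply: uniq_perm.
- exact: fset_uniq.
- rewrite cat_uniq fset_uniq map_inj_in_uniq ?fset_uniq ?andbT/=.
    apply/hasPn => _ /mapP[s _ ->]; rewrite fpowersetE.
    by apply: contra xX => /fsubsetP; apply; rewrite fset1U1.
  move=> s t; rewrite !fpowersetE => sX tX.
  move=> /(congr1 (fun u => u `\ x)); rewrite !fsetU1K//.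
    by apply: contra xX; apply/fsubsetP.
  by apply: contra xX; apply/fsubsetP.
- move=> s; rewrite mem_cat !fpowersetE; apply/idP/orP.
    move=> sxX; have [xs|xs] := boolP (x \in s); [right|left].
      apply/mapP; exists (s `\ x); last by rewrite fsetD1K.
      by rewrite fpowersetE fsubDset.
    apply/fsubsetP => y ys; have := fsubsetP sxX y ys.
    by rewrite in_fset1U => /predU1P[yx|//]; rewrite -yx ys in xs.
  case=> [sX|/mapP[t]]; first exact: fsubset_trans sX (fsubsetU1 _ _).
  by rewrite fpowersetE => tX ->; exact: fsetUS.
Qed.

Definition signed_sum X Q : R := \sum_(s <- fpowerset X) (-1) ^+ #|` s| * Q s.

Lemma signed_sumU1_notin x X Q : x \notin X ->
  signed_sum (x |` X) Q = signed_sum X Q - signed_sum X (fun s => Q (x |` s)).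
Proof.
move=> xX; rewrite /signed_sum (perm_big _ (perm_fpowersetU1 xX))/=.
rewrite big_cat/= [X in (_ + X)%R]big_map; congr (_ + _)%R.
rewrite -sumrN big_seq [RHS]big_seq; apply: eq_bigr => s.
rewrite fpowersetE => sX; rewrite cardfsU1 (_ : x \notin s); last first.
  by apply: contra xX; apply/fsubsetP.
by rewrite add1n exprS mulN1r mulNr.
Qed.

(** For a point that is already present the last sum vanishes, so the recursion
    along a sample does not see repeated points. *)
Lemma signed_sumU1 x X Q :
  signed_sum (x |` X) Q = signed_sum X Q - signed_sum X (fun s => Q (x |` s)).
Proof.
have [xX|] := boolP (x \in X); last exact: signed_sumU1_notin.
rewrite (_ : x |` X = X); last by apply/fsetUidPr; rewrite fsub1set.
rewrite -[in X in (_ - X)%R](fsetD1K xX) signed_sumU1_notin ?fsetD11//.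
rewrite (_ : (fun s => Q (x |` (x |` s))) = fun s => Q (x |` s)).
  by rewrite subrr subr0.
by apply/funext => s; rewrite fsetUA fsetUid.
Qed.

(** The signs of the masks that select a given set of points add up to the sign of
    that set, also when the sample has repeated points. *)
Lemma signed_sum_masks (s : seq T) Q :
  signed_sum [fset y in s] Q =
  \sum_(m <- masks (size s)) (-1) ^+ count id m * Q [fset y in mask m s].
Proof.
elim: s Q => [|x s IH] Q.
  rewrite /= big_seq1 /= /signed_sum.
  have -> : [fset y in [::] : seq T] = fset0 by apply/fsetP => y; rewrite !inE.
  by rewrite fpowerset0 big_seq_fset1 cardfs0.
rewrite /= big_cat/= !big_map/=.
have consE (t : seq T) : [fset y in x :: t] = x |` [fset y in t].
  by apply/fsetP => y; rewrite !inE.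
rewrite consE signed_sumU1 !IH; congr (_ + _)%R.
rewrite -sumrN; apply: eq_bigr => m _.
by rewrite consE exprS mulN1r mulNr.
Qed.

End inclusion_exclusion.

Section expectation.
Context {dsp : measure_display} {T : measurableType dsp} {R : realType}.

Fixpoint tuple_mask (m : bitseq) : (size m).-tuple T -> (count id m).-tuple T :=
  match m with
  | [::] => fun=> [tuple]
  | b :: m' => fun t =>
    if b as b' return ((b' + count id m')%N).-tuple T
    then tuple_cons (thead t, tuple_mask (m := m') [tuple of behead t])
    else tuple_mask (m := m') [tuple of behead t]
  end.

Lemma val_tuple_mask m (t : (size m).-tuple T) : tuple_mask t = mask m t :> seq T.
Proof.
elim: m t => [|[] m IH] t; first by rewrite (tuple0 t).
  by case/tupleP: t => x t /=; congr (_ :: _); rewrite IH.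
by case/tupleP: t => x t /=; rewrite IH.
Qed.

Lemma measurable_tuple_mask m : measurable_fun setT (@tuple_mask m).
Proof.
elim: m => [|b m IH]; first exact: measurable_cst.
have mtail := measurableT_comp IH (@measurable_behead _ T (size m)).
case: b => //; apply: (measurableT_comp (@measurable_tuple_cons _ T (count id m))).
apply/measurable_fun_pairP; split => //.
exact: measurable_tnth.
Qed.

Lemma tuple_mask_cons b m (x : T) (s : (size m).-tuple T) :
  @tuple_mask (b :: m) (tuple_cons (x, s)) =
  if b as b' return ((b' + count id m)%N).-tuple T
  then tuple_cons (x, tuple_mask s) else tuple_mask s.
Proof.
have consK : [tuple of behead (tuple_cons (x, s))] = s :> (size m).-tuple T.
  exact/val_inj.
by case: b => /=; rewrite consK.
Qed.

(** Under a product of probability measures the coordinates that a mask selects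
    are again a sample. *)
Lemma integral_tuple_mask (mu : {sigma_finite_measure set T -> \bar R}) m
    (h : (count id m).-tuple T -> \bar R) :
  (mu setT = 1 -> measurable_fun setT h -> (forall t, 0 <= h t) ->
  \int[tuple_measure mu (size m)]_t h (tuple_mask t) =
  \int[tuple_measure mu (count id m)]_t h t)%E.
Proof.
move=> mu1; elim: m h => [|b m IH] h mh h0.
  by apply: eq_integral => t _; congr h; rewrite (tuple0 t).
have mhm := measurableT_comp mh (@measurable_tuple_mask (b :: m)).
rewrite [LHS]ge0_integral_tupleS//; case: b h mh h0 mhm => h mh h0 mhm.
  rewrite [RHS]ge0_integral_tupleS//; apply: eq_integral => x _.
  under eq_integral do rewrite tuple_mask_cons.
  apply: (IH (fun s => h (tuple_cons (x, s)))) => //.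
  exact: measurable_tuple_cons_section.
under eq_integral do under eq_integral do rewrite tuple_mask_cons.
rewrite [X in integral _ _ X](_ : _ = cst (\int[tuple_measure mu (count id m)]_t h t)%E).
  by rewrite integral_cst// -[RHS]mule1; congr (_ * _)%E.
by apply/funext => x; exact: IH.
Qed.

Lemma bounded_integrable_prob d' (X : measurableType d')
    (mu : {measure set X -> \bar R}) (h : X -> R) M : mu setT = 1%E ->
  measurable_fun setT h -> (forall x, `|h x| <= M) -> mu.-integrable setT (EFin \o h).
Proof.
move=> mu1 mh hM; apply: measurable_bounded_integrable => //.
  by rewrite mu1 ltry.
exists M; split; first exact: num_real.
by move=> N MN x _ /=; rewrite (le_trans (hM x))// ltW.
Qed.

Lemma Rintegral_lincomb d' (X : measurableType d')
    (mu : {measure set X -> \bar R}) I (s : seq I) (c : I -> R) (h : I -> X -> R) :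
  (forall i, mu.-integrable setT (EFin \o h i)) ->
  \int[mu]_x (\sum_(i <- s) c i * h i x) = \sum_(i <- s) c i * \int[mu]_x h i x.
Proof.
move=> ih.
have ich i : mu.-integrable setT (EFin \o (fun x => c i * h i x)).
  rewrite (_ : _ \o _ = (fun x => (c i)%:E * (h i x)%:E)%E); last first.
    by apply/funext => x; rewrite /= EFinM.
  exact: (integrableZl measurableT (c i) (ih i)).
rewrite /Rintegral; under eq_integral do rewrite -sumEFin.
rewrite integral_sum// -sum_fine//=; last first.
  by move=> i _; exact: (integrable_fin_num measurableT (ich i)).
by apply: eq_bigr => i _; rewrite -RintegralZl.
Qed.

Lemma measurable_mask (P : seq T -> R) n m :
  (forall k, measurable_fun setT (fun t : k.-tuple T => P t)) -> size m = n ->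
  measurable_fun setT (fun t : n.-tuple T => P (mask m t)).
Proof.
move=> mP <-; rewrite (_ : (fun t => _) = (fun t => P t) \o @tuple_mask m).
  exact: (measurableT_comp (mP _) (@measurable_tuple_mask m)).
by apply/funext => t /=; rewrite val_tuple_mask.
Qed.

Lemma expected_signed_sum_masks (mu : {sigma_finite_measure set T -> \bar R}) n
    (P : seq T -> R) :
  mu setT = 1%E -> (forall s, 0 <= P s <= 1) ->
  (forall k, measurable_fun setT (fun t : k.-tuple T => P t)) ->
  \int[tuple_measure mu n]_t
     (\sum_(m <- masks n) (-1) ^+ count id m * P (mask m t)) =
  \sum_(k < n.+1) (-1) ^+ k * 'C(n, k)%:R * \int[tuple_measure mu k]_t P t.
Proof.
move=> mu1 P01 mP.
pose q k := \int[tuple_measure mu k]_t P t.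
rewrite -(sum_masks n q).
have P1 s : `|P s| <= 1 by have /andP[? ?] := P01 s; rewrite ger0_norm.
rewrite [LHS](_ : _ = \int[tuple_measure mu n]_t (\sum_(m <- masks n)
    (-1) ^+ count id m * (if size m == n then P (mask m t) else 0))); last first.
  apply: eq_Rintegral => t _; rewrite big_seq [RHS]big_seq.
  by apply: eq_bigr => m /size_masks ->; rewrite eqxx.
rewrite Rintegral_lincomb; last first.
  move=> m; apply: (bounded_integrable_prob (M := 1)).
  - exact: tuple_measure_setT.
  - by case: eqP => // mn; exact: measurable_mask.
  - by move=> t; case: ifP => // _; rewrite normr0.
rewrite big_seq [RHS]big_seq; apply: eq_bigr => m /size_masks mn.
congr (_ * _); rewrite /q /Rintegral mn eqxx; congr fine.
rewrite -[RHS](integral_tuple_mask (m := m))//; last 2 first.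
- by apply/measurable_EFinP; exact: (mP (count id m)).
- by move=> t; rewrite lee_fin; have /andP[] := P01 t.
by subst n; apply: eq_integral => t _; rewrite val_tuple_mask.
Qed.

End expectation.

(** * The Čech complex and its simplices *)

Section cech_combinatorics.
Context {R : realType} {d : nat}.
Implicit Types (r : R) (x y : euclid R d) (s : seq (euclid R d)).

Definition meeting_balls r s : bool :=
  `[< exists y, forall x, x \in s -> eucl_dist x y <= r >].

Lemma meeting_balls0 r : meeting_balls r [::].
Proof. by apply/asboolP; exists [tuple (0 : R) | i < d]. Qed.

Lemma meeting_balls_fset r s :
  `[< \bigcap_(x in [set` [fset y in s]%fset]) eucl_cball x r !=set0 >] =
  meeting_balls r s.
Proof.
apply/asboolP/asboolP => -[y Hy]; exists y => x.
  by move=> xs; apply: Hy; rewrite /= inE.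
by rewrite /= inE => xs; exact: Hy.
Qed.

(** The empty set is excluded from the complex, while the empty mask contributes
    [1] to the sum: hence the leading [1]. *)
Lemma euler_char_cech r s :
  euler_char (cech_complex r [fset y in s]%fset) =
  1 - \sum_(m <- masks (size s))
        (-1) ^+ count id m * (meeting_balls r (mask m s))%:R.
Proof.
pose Q (X : {fset euclid R d}) : R :=
  (`[< \bigcap_(x in [set` X]) eucl_cball x r !=set0 >])%:R.
rewrite [X in _ - X](_ : _ = signed_sum [fset y in s]%fset Q); last first.
  rewrite signed_sum_masks; apply: eq_bigr => m _.
  by rewrite /Q meeting_balls_fset.
rewrite /signed_sum (big_fsetD1 fset0) ?fpowersetE ?fsub0set//=.
rewrite expr0 mul1r.
have -> : Q fset0 = 1.
  rewrite /Q asboolT//; exists [tuple (0 : R) | i < d] => x /=.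
  by rewrite inE.
rewrite opprD addrA subrr add0r -sumrN.
rewrite /euler_char /cech_complex big_fset/=.
rewrite big_mkcond/= (big_fsetD1 fset0) ?fpowersetE ?fsub0set//=.
rewrite add0r big_seq [RHS]big_seq/=.
apply: eq_bigr => X; rewrite !inE => /andP[X0 _]; rewrite X0/= /Q.
case: asboolP => _; last by rewrite mulr0 oppr0.
rewrite mulr1 -[in RHS](@prednK #|` X|%fset) ?cardfs_gt0//.
by rewrite exprS mulN1r opprK.
Qed.

End cech_combinatorics.

Section cech_geometry.
Context {R : realType} {d : nat}.
Implicit Types (r : R) (x y : euclid R d) (s : seq (euclid R d)).

Definition sqdist x y : R := \sum_(i < d) ((tnth x i : R) - tnth y i) ^+ 2.

Lemma sqdist_ge0 x y : 0 <= sqdist x y.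
Proof. by apply: sumr_ge0 => i _; exact: sqr_ge0. Qed.

Lemma sqdistC x y : sqdist x y = sqdist y x.
Proof. by apply: eq_bigr => i _; rewrite -sqrrN opprB. Qed.

Lemma eucl_dist_le x y r : 0 <= r -> (eucl_dist x y <= r) = (sqdist x y <= r ^+ 2).
Proof.
move=> r0; rewrite -[in LHS](ger0_norm r0) -sqrtr_sqr ler_psqrt//.
by rewrite nnegrE sqdist_ge0.
by rewrite nnegrE sqr_ge0.
Qed.

Lemma meeting_ballsP r s : 0 <= r ->
  reflect (exists y, forall x, x \in s -> sqdist x y <= r ^+ 2) (meeting_balls r s).
Proof.
move=> r0; apply: (iffP (asboolP _)) => -[y Hy]; exists y => x xs.
  by rewrite -eucl_dist_le//; exact: Hy.
by rewrite eucl_dist_le//; exact: Hy.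
Qed.

Lemma sqr_coord_le_sqdist x y i : ((tnth x i : R) - tnth y i) ^+ 2 <= sqdist x y.
Proof.
by rewrite /sqdist (bigD1 i)//= lerDl; apply: sumr_ge0 => j _; exact: sqr_ge0.
Qed.

Let point (v : 'rV[R]_d) : euclid R d := [tuple v ord0 i | i < d].

Lemma sqdist_continuous x : continuous (fun v : 'rV[R]_d => sqdist x (point v)).
Proof.
apply: continuous_big => [|i _ v].
  exact: add_continuous.
under eq_fun do rewrite tnth_mktuple.
apply: (@continuous_comp _ _ _ (fun v : 'rV[R]_d => (tnth x i : R) - v ord0 i)
   (fun u : R => u ^+ 2)); last exact: exprn_continuous.
move: (tnth x i : R) => c.
have cst_cont : {for v, continuous (fun _ : 'rV[R]_d => c)}.
  exact: cst_continuous.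
have coord_cont : {for v, continuous (fun v : 'rV[R]_d => v ord0 i)}.
  exact: coord_continuous.
exact: (continuousB cst_cont coord_cont).
Qed.

(** The infimum over centres is attained because the centres range over a
    compact set. *)
Lemma meeting_balls_limit r s : 0 <= r ->
  (forall n : nat, exists y, forall x, x \in s -> sqdist x y <= r ^+ 2 + n.+1%:R^-1) ->
  meeting_balls r s.
Proof.
move=> r0 /choice[y Hy]; case: s => [|x0 s] in Hy *; first exact: meeting_balls0.
pose K n := [set v : 'rV[R]_d |
  forall x, x \in x0 :: s -> sqdist x (point v) <= r ^+ 2 + n.+1%:R^-1].
have clK n : closed (K n).
  rewrite (_ : K n = \bigcap_(x in [set` x0 :: s])
      ((fun v => sqdist x (point v)) @^-1` [set u | u <= r ^+ 2 + n.+1%:R^-1])).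
    apply: closed_bigI => x _; apply: preimage_closed; last exact: closed_le.
    by move=> v _; exact: sqdist_continuous.
  by apply/seteqP; split => v /=; [move=> Kv x /Kv|move=> Kv x /Kv].
pose v n : 'rV[R]_d := \row_i tnth (y n) i.
have pv n : point (v n) = y n.
  by apply/eq_from_tnth => i; rewrite tnth_mktuple mxE.
have Kv n m : (n <= m)%N -> K n (v m).
  move=> nm x xs; rewrite pv (le_trans (Hy m x xs))// lerD2l.
  by rewrite lef_pV2 ?posrE// ler_nat.
have := @rV_compact R d (fun i => `[(tnth x0 i : R) - (r + 1), tnth x0 i + (r + 1)]%classic).
move=> /(_ (fun i => @segment_compact _ _ _)) /(_ (v @ \oo) _) [].
  exists 0%N => // n _ i /=; rewrite in_itv/=.
  have /= := Kv 0%N n isT x0 (mem_head _ _); rewrite pv => x0n.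
  have := le_trans (sqr_coord_le_sqdist x0 (y n) i) x0n.
  rewrite invr1 mxE => H.
  have : `|(tnth x0 i : R) - tnth (y n) i| <= r + 1.
    rewrite -(@ler_pXn2r _ 2)// ?nnegrE ?addr_ge0//.
    rewrite real_normK ?num_real// (le_trans H)//.
    by rewrite sqrrD expr1n mulr1 lerD2r lerDl mulrn_wge0.
  by rewrite ler_distlC.
move=> w [_]; rewrite clusterE => clw.
have Kw n : K n w.
  rewrite (closure_id (K n)).1//; apply: clw; exists n => // m /= nm.
  exact: Kv.
apply/meeting_ballsP => //; exists (point w) => x xs.
apply/ler_addgt0Pr => e e0.
near \oo => n; apply: (le_trans (Kw n x xs)); rewrite lerD2l ltW//.
by near: n; exact: near_infty_natSinv_lt (PosNum e0).
Unshelve. all: by end_near. Qed.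

Let rpoint (q : d.-tuple rat) : euclid R d := [tuple ratr (tnth q i) | i < d].

(** Moving the common point of the balls to a nearby rational point costs an
    arbitrarily small increase of the squared radius. *)
Lemma sqdist_rat_approx r y (e : R) : 0 <= r -> 0 < e ->
  exists q, forall x, sqdist x y <= r ^+ 2 -> sqdist x (rpoint q) <= r ^+ 2 + e.
Proof.
move=> r0 e0.
(* A coordinate displaced by [del <= 1] changes the square by at most
   [2 * r * del + del ^+ 2 <= (2 * r + 1) * del]; the final [1] keeps [c]
   positive for [d = 0]. *)
pose c := d%:R * (2 * r + 1) + 1 : R.
have c0 : 0 < c by rewrite ltr_wpDl// mulr_ge0// addr_ge0// mulr_ge0.
pose del := Num.min 1 (e / c).
have del0 : 0 < del by rewrite lt_min ltr01 divr_gt0.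
have /choice[q Hq] : forall i : 'I_d, exists q : rat,
    `|(tnth y i : R) - ratr q| <= del.
  move=> i; have [q] := @rat_in_itvoo R (tnth y i) ((tnth y i : R) + del) ltac:(by rewrite ltrDl).
  rewrite in_itv/= => /andP[q1 q2]; exists q.
  by rewrite ler_distl lerBlDr (ltW q2)/= (le_trans (ltW q1))// lerDl ltW.
exists [tuple q i | i < d] => x xy.
have H i : ((tnth x i : R) - tnth (rpoint [tuple q i | i < d]) i) ^+ 2 <=
    ((tnth x i : R) - tnth y i) ^+ 2 + (2 * r * del + del ^+ 2).
  rewrite !tnth_mktuple.
  have -> : (tnth x i : R) - ratr (q i) =
    ((tnth x i : R) - tnth y i) + ((tnth y i : R) - ratr (q i)) by ring.
  have xyi : `|(tnth x i : R) - tnth y i| <= r.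
    rewrite -(@ler_pXn2r _ 2)// real_normK ?num_real//.
    exact: le_trans (sqr_coord_le_sqdist x y i) xy.
  move: (Hq i) xyi; set a := _ - tnth y i; set b := _ - ratr _ => bd ar.
  rewrite sqrrD -addrA lerD2l; apply: lerD.
    rewrite (le_trans (ler_norm _))// normrMn normrM -[leLHS]mulr_natl -mulrA.
    by rewrite ler_pM2l// ler_pM.
  by rewrite -(real_normK (num_real b)) ler_pXn2r// ?nnegrE// ltW.
apply: (le_trans (ler_sum _ (fun i _ => H i))).
rewrite big_split/= lerD//; rewrite sumr_const card_ord -[leLHS]mulr_natl.
have del1 : del <= 1 by rewrite ge_min lexx.
have delc : del * c <= e by rewrite -ler_pdivlMr// ge_min lexx orbT.
apply: le_trans delc; apply: (@le_trans _ _ (del * (d%:R * (2 * r + 1)))).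
  rewrite [leRHS]mulrCA; apply: ler_wpM2l => //.
  rewrite mulrDr mulr1 [del * _]mulrC lerD2l expr2.
  by rewrite ger_pMr.
by rewrite /c [leRHS]mulrDr mulr1 lerDl ltW.
Qed.

Lemma measurable_sqdist y : measurable_fun setT (sqdist ^~ y).
Proof.
apply: measurable_sum => i; apply: measurable_funX.
apply: measurable_funB => //; exact: measurable_tnth.
Qed.

(** The existence of a common point is a projection; by compactness it can be
    written with rational centres and radii slightly larger than [r], which uses
    only countable operations on measurable sets. *)
Lemma measurable_meeting_balls r k : 0 <= r ->
  measurable_fun setT (fun t : k.-tuple (euclid R d) => (meeting_balls r t)%:R : R).
Proof.
move=> r0.
pose B (n : nat) (q : d.-tuple rat) := [set x | sqdist x (rpoint q) <= r ^+ 2 + n.+1%:R^-1].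
have mB n q : measurable (B n q).
  rewrite /B -[X in measurable X]setTI -preimage_itvNyc.
  by apply: measurable_sqdist => //; exact: measurable_itv.
pose A := \bigcap_(n : nat) \bigcup_(j : nat)
  (if choice.unpickle j is Some q then
     [set t : k.-tuple (euclid R d) | forall i, B n q (tnth t i)] else set0).
have mA : measurable A.
  apply: bigcapT_measurable => n; apply: bigcupT_measurable => j.
  case: (choice.unpickle j) => [q|]; last exact: measurable0.
  by apply: (measurable_tuple_box (B := fun=> B n q)).
rewrite (_ : (fun t => _) = \1_A); first exact: measurable_indic.
apply/funext => t; rewrite indicE; congr (_%:R); congr nat_of_bool.
apply/idP/idP; rewrite inE.
  move=> /(meeting_ballsP _ r0)[y Hy] n _.
  have [q Hq] := @sqdist_rat_approx r y n.+1%:R^-1 r0 ltac:(by rewrite invr_gt0).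
  exists (choice.pickle q) => //; rewrite choice.pickleK => i; apply: Hq; apply: Hy.
  exact: mem_tnth.
move=> At; apply: meeting_balls_limit => // n.
have [j _] := At n I; case: (choice.unpickle j) => // q Hq.
by exists (rpoint q) => x /tnthP[i ->]; exact: Hq.
Qed.

End cech_geometry.

Section scaling.
Context {R : realType} {d : nat}.
Implicit Types (r : R) (x y : euclid R d).

Definition origin : euclid R d := [tuple (0 : R) | i < d].

Lemma sqdist_homothety x r y z :
  sqdist (homothety x r y) (homothety x r z) = r ^+ 2 * sqdist y z.
Proof.
rewrite /sqdist mulr_sumr; apply: eq_bigr => i _.
by rewrite !tnth_mktuple -exprMn; congr (_ ^+ 2); ring.
Qed.

Lemma homothety_origin x r : homothety x r origin = x.
Proof. by apply/eq_from_tnth => i; rewrite !tnth_mktuple mulr0 addr0. Qed.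

Lemma homothetyVK x r z : r != 0 ->
  homothety x r [tuple r^-1 * ((tnth z i : R) - tnth x i) | i < d] = z.
Proof.
move=> r0; apply/eq_from_tnth => i; rewrite !tnth_mktuple mulrA divff// mul1r.
by rewrite addrC subrK.
Qed.

Lemma meeting_balls_homothety x r (t : seq (euclid R d)) : 0 < r ->
  meeting_balls r (x :: map (homothety x r) t) = meeting_balls 1 (origin :: t).
Proof.
move=> r0; rewrite (_ : x :: _ = map (homothety x r) (origin :: t)); last first.
  by rewrite /= homothety_origin.
have sq y z : (sqdist (homothety x r y) (homothety x r z) <= r ^+ 2) =
    (sqdist y z <= 1 ^+ 2).
  by rewrite sqdist_homothety -[leRHS]mulr1 expr1n ler_pM2l// exprn_gt0.
apply/(meeting_ballsP _ (ltW r0))/(meeting_ballsP _ ler01) => -[z Hz].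
  exists [tuple r^-1 * ((tnth z i : R) - tnth x i) | i < d] => y yt.
  by rewrite -sq homothetyVK ?gt_eqF//; apply: Hz; exact: map_f.
by exists (homothety x r z) => _ /mapP[y yt ->]; rewrite sq; exact: Hz.
Qed.

(** The volume of configurations is finite because the points of a simplex that
    contains the origin are within distance [2] of it. *)
Lemma meeting_unit_balls_bounded (t : seq (euclid R d)) y i :
  meeting_balls 1 (origin :: t) -> y \in t -> - 2 <= (tnth y i : R) <= 2.
Proof.
move=> /(meeting_ballsP _ ler01)[z Hz] yt.
have le1 (w : euclid R d) : sqdist w z <= 1 ^+ 2 -> `|(tnth w i : R) - tnth z i| <= 1.
  move=> wz; rewrite -(@ler_pXn2r _ 2)// ?nnegrE// real_normK ?num_real//.
  exact: le_trans (sqr_coord_le_sqdist w z i) wz.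
have /le1 := Hz _ (mem_head _ _).
have /le1 : sqdist y z <= 1 ^+ 2 by apply: Hz; rewrite inE yt orbT.
rewrite tnth_mktuple sub0r normrN !ler_norml => /andP[? ?] /andP[? ?].
by apply/andP; split; lra.
Qed.

(** The volume of configurations is positive because the origin itself lies in
    all unit balls whose centres are close to it. *)
Lemma meeting_unit_balls_near (t : seq (euclid R d)) :
  (forall y, y \in t -> sqdist origin y <= 1) -> meeting_balls 1 (origin :: t).
Proof.
move=> Ht; apply/(meeting_ballsP _ ler01); exists origin => y.
rewrite inE expr1n => /predU1P[->|/Ht]; last by rewrite sqdistC.
by rewrite /sqdist big1// => i _; rewrite subrr expr0n.
Qed.

End scaling.
Arguments origin {R d}.

Section volumes.
Local Open Scope ereal_scope.
Context {R : realType} {d : nat}.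
Implicit Types (j : nat).

Definition cube (a : R) : set (euclid R d) :=
  [set y | forall i, `[(- a)%R, a]%classic (tnth y i)].

Lemma measurable_cube a : measurable (cube a).
Proof.
by apply: (measurable_tuple_box (B := fun=> `[(- a)%R, a]%classic)) => i.
Qed.

Lemma lebesgue_cube (a : R) : (0 <= a)%R ->
  lebesgue_tuple (cube a) = ((2 * a) ^+ d)%:E.
Proof.
move=> a0; transitivity (\prod_(i < d) lebesgue_measure (`[(- a)%R, a]%classic : set R)).
  exact: (tuple_measure_box lebesgue_measure (B := fun=> `[(- a)%R, a]%classic)).
rewrite (eq_bigr (fun=> (2 * a)%:E)).
  by rewrite prodEFin prodr_const card_ord.
move=> i _; rewrite lebesgue_measure_itv/= lte_fin.
case: ltP => // [_|aa]; first by rewrite -EFinD; congr (_%:E); ring.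
have -> : a = 0%R by apply/eqP; rewrite eq_le a0 andbT; lra.
by rewrite mulr0.
Qed.

Lemma lebesgue_cubes j (a : R) : (0 <= a)%R ->
  tuple_measure lebesgue_tuple j
    [set t : j.-tuple (euclid R d) | forall k, cube a (tnth t k)] =
  (((2 * a) ^+ d) ^+ j)%:E.
Proof.
move=> a0; transitivity (\prod_(k < j) lebesgue_tuple (cube a)).
  apply: (tuple_measure_box lebesgue_tuple (B := fun=> cube a)) => k.
  exact: measurable_cube.
rewrite (eq_bigr (fun=> ((2 * a) ^+ d)%:E)).
  by rewrite prodEFin prodr_const card_ord.
by move=> k _; rewrite lebesgue_cube.
Qed.

Lemma measurable_cubes j (a : R) :
  measurable [set t : j.-tuple (euclid R d) | forall k, cube a (tnth t k)].
Proof.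
apply: (measurable_tuple_box (B := fun=> cube a)) => k; exact: measurable_cube.
Qed.

Lemma integral_cubes j (a : R) : (0 <= a)%R ->
  \int[tuple_measure lebesgue_tuple j]_t
    (\1_[set t : j.-tuple (euclid R d) | forall k, cube a (tnth t k)] t : R)%:E =
  (((2 * a) ^+ d) ^+ j)%:E.
Proof.
move=> a0; transitivity (tuple_measure lebesgue_tuple j
    [set t : j.-tuple (euclid R d) | forall k, cube a (tnth t k)]).
  by rewrite integral_indic ?setIT//; exact: measurable_cubes.
exact: lebesgue_cubes.
Qed.

Definition cech_link j (t : j.-tuple (euclid R d)) : R :=
  (meeting_balls 1 (origin :: t))%:R.

(** The factor that remains of the probability of a [j]-simplex once the scale
    and the density have been separated from it. *)
Definition cech_volume j : R := \int[tuple_measure lebesgue_tuple j]_t cech_link t.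

Lemma cech_link01 j (t : j.-tuple (euclid R d)) : (0 <= cech_link t <= 1)%R.
Proof. by rewrite /cech_link; case: meeting_balls; rewrite !lexx !ler01. Qed.

Lemma measurable_cech_link j : measurable_fun setT (@cech_link j).
Proof.
have mt := @measurable_meeting_balls R d 1 j.+1 ler01.
exact: (measurableT_comp mt (measurableT_comp (@measurable_tuple_cons _ _ j)
  (pair1_measurable _))).
Qed.

Lemma cech_link_le_cube j (t : j.-tuple (euclid R d)) :
  (cech_link t <= \1_[set t : j.-tuple (euclid R d) | forall k, cube 2 (tnth t k)] t)%R.
Proof.
rewrite /cech_link; case: (boolP (meeting_balls _ _)) => [meet|_]; last first.
  by rewrite indicE; case: (_ \in _).
rewrite indicE mem_set// => k i /=; rewrite in_itv/=.
by apply: (meeting_unit_balls_bounded i meet); exact: mem_tnth.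
Qed.

(* [4 ^+ d] is the volume of the cube of half-side [2]. *)
Lemma integral_cech_link_le j :
  \int[tuple_measure lebesgue_tuple j]_t (cech_link t)%:E <= (((4 ^+ d) ^+ j)%R)%:E.
Proof.
apply: (@le_trans _ _ (\int[tuple_measure lebesgue_tuple j]_t
  (\1_[set t : j.-tuple (euclid R d) | forall k, cube 2 (tnth t k)] t)%:E)).
  apply: ge0_le_integral => //.
  - by move=> t _; rewrite lee_fin; have /andP[] := cech_link01 t.
  - by apply/measurable_EFinP; exact: measurable_cech_link.
  - by apply/measurable_EFinP; apply: measurable_indic; exact: measurable_cubes.
  - by move=> t _; rewrite lee_fin; exact: cech_link_le_cube.
by rewrite integral_cubes// -natrM.
Qed.

Lemma integrable_cech_link j :
  (tuple_measure lebesgue_tuple j).-integrable setT (EFin \o @cech_link j).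
Proof.
apply/integrableP; split; first by apply/measurable_EFinP; exact: measurable_cech_link.
under eq_integral => t _.
  rewrite /= ger0_norm; last by have /andP[] := cech_link01 t.
  over.
by rewrite (le_lt_trans (integral_cech_link_le j))// ltry.
Qed.

Lemma EFin_cech_volume j :
  (cech_volume j)%:E = \int[tuple_measure lebesgue_tuple j]_t (cech_link t)%:E.
Proof.
rewrite /cech_volume /Rintegral fineK//.
exact: (integrable_fin_num measurableT (integrable_cech_link j)).
Qed.

Lemma cech_volume_le j : (cech_volume j <= (4 ^+ d) ^+ j)%R.
Proof. by rewrite -lee_fin EFin_cech_volume integral_cech_link_le. Qed.

Hypothesis d_gt0 : (0 < d)%N.

(* A cube of half-side [1 / d] lies in the unit ball, since a sum of [d] squares
   of size [1 / d ^+ 2] is at most [1]. *)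
Let small : R := d%:R^-1.

Let cube_sqdist (y : euclid R d) : cube small y -> (sqdist origin y <= 1)%R.
Proof.
move=> Hy; apply: (@le_trans _ _ (\sum_(i < d) d%:R^-1)%R); last first.
  by rewrite sumr_const card_ord -[leLHS]mulr_natl divff// pnatr_eq0 -lt0n.
apply: ler_sum => i _; have := Hy i; rewrite /= in_itv/= -ler_norml => yi.
rewrite tnth_mktuple sub0r sqrrN -real_normK ?num_real//.
apply: (@le_trans _ _ (small ^+ 2)%R); first by rewrite ler_pXn2r ?nnegrE ?invr_ge0.
by rewrite expr2 ler_piMr ?invr_ge0// invf_le1 ?ler1n// ltr0n.
Qed.

Lemma cech_volume_gt0 j : (0 < cech_volume j)%R.
Proof.
have small0 : (0 < small)%R by rewrite invr_gt0 ltr0n.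
apply: (@lt_le_trans _ _ (((2 * small) ^+ d) ^+ j)%R).
  by do 2 apply: exprn_gt0; rewrite mulr_gt0.
rewrite -lee_fin EFin_cech_volume.
apply: (@le_trans _ _ (\int[tuple_measure lebesgue_tuple j]_t
  (\1_[set t : j.-tuple (euclid R d) | forall k, cube small (tnth t k)] t)%:E)).
  by rewrite integral_cubes// ltW.
apply: ge0_le_integral => //.
- by apply/measurable_EFinP; apply: measurable_indic; exact: measurable_cubes.
- by apply/measurable_EFinP; exact: measurable_cech_link.
- move=> t _; rewrite lee_fin indicE; case: (boolP (t \in _)) => [|_]; last first.
    by have /andP[] := cech_link01 t.
  rewrite inE /= => Ht; rewrite /cech_link meeting_unit_balls_near//.
  by move=> y /tnthP[k ->]; exact: cube_sqdist.
Qed.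

Lemma unit_ball_volume_gt0 : (0 < @unit_ball_volume R d)%R.
Proof.
have small0 : (0 < small)%R by rewrite invr_gt0 ltr0n.
have ballE : eucl_cball (@origin R d) (1 : R) = [set y : euclid R d | (sqdist origin y <= 1)%R].
  by apply/seteqP; split => y /=; rewrite /eucl_cball/= eucl_dist_le// expr1n.
have mball : measurable (eucl_cball (@origin R d) 1).
  rewrite ballE (_ : [set y | _] = [set y | (sqdist y origin <= 1)%R]).
    rewrite -[X in measurable X]setTI -preimage_itvNyc.
    by apply: measurable_sqdist => //; exact: measurable_itv.
  by apply/seteqP; split => y /=; rewrite sqdistC.
apply: (@lt_le_trans _ _ ((2 * small) ^+ d)%R).
  by apply: exprn_gt0; rewrite mulr_gt0.
have ball_le : lebesgue_tuple (eucl_cball (@origin R d) 1) <= ((2 * 1) ^+ d)%:E.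
  rewrite -lebesgue_cube//; apply: le_measure; rewrite ?inE//.
    exact: measurable_cube.
  rewrite ballE => y /= y1 i; rewrite /= in_itv/= -ler_norml.
  rewrite -(@ler_pXn2r _ 2)// ?nnegrE// real_normK ?num_real// expr1n.
  apply: le_trans y1; have := sqr_coord_le_sqdist origin y i.
  by rewrite tnth_mktuple sub0r sqrrN.
rewrite -lee_fin /unit_ball_volume -/origin fineK.
  rewrite -lebesgue_cube ?(ltW small0)//; apply: le_measure; rewrite ?inE//.
    exact: measurable_cube.
  by rewrite ballE => y; exact: cube_sqdist.
by rewrite ge0_fin_numE// (le_lt_trans ball_le)// ltry.
Qed.

End volumes.
Arguments cech_volume {R} d j.

(** * Continuity of translations in the mean *)

(** The proof avoids the density of continuous functions in L1: the sets that are
    almost invariant under small translations form a sigma-algebra, which contains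
    the half-spaces, and a bounded function is nearly a combination of finitely
    many indicators. *)
Section asymptotic_invariance.
Local Open Scope ereal_scope.
Context {dsp : measure_display} {X : measurableType dsp} {R : realType}.
Variables (F : {measure set X -> \bar R}) (T : nat -> X -> X).
Hypothesis mT : forall n, measurable_fun setT (T n).

Let mpre n A : measurable A -> measurable (T n @^-1` A).
Proof. by move=> mA; rewrite -[X in measurable X]setTI; exact: mT. Qed.

Definition asymptotically_invariant (A : set X) : Prop :=
  measurable A /\ forall e : R, (0 < e)%R ->
    \forall n \near \oo, F ((T n @^-1` A) `+` A) <= e%:E.

Lemma asymptotically_invariantC A :
  asymptotically_invariant A -> asymptotically_invariant (~` A).
Proof.
move=> [mA HA]; split; first exact: measurableC.
move=> e /HA; apply: filterS => n; congr (F _ <= _).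
apply/seteqP; split => x /= [[a b]|[a b]]; [right|left|right|left]; split => //;
  exact: contrapT.
Qed.

Let measurable_symdiff n A : measurable A -> measurable ((T n @^-1` A) `+` A).
Proof. by move=> mA; apply: measurableU; apply: measurableD => //; exact: mpre. Qed.

Let le_measureU (A B C : set X) : measurable A -> measurable B -> measurable C ->
  C `<=` A `|` B -> F C <= F A + F B.
Proof.
move=> mA mB mC CAB; apply: (le_trans _ (measureU2 _ mA mB)).
by apply: le_measure; rewrite ?inE//; exact: measurableU.
Qed.

Lemma asymptotically_invariantU A B :
  asymptotically_invariant A -> asymptotically_invariant B ->
  asymptotically_invariant (A `|` B).
Proof.
move=> [mA HA] [mB HB]; split; first exact: measurableU.
move=> e e0; have e20 : (0 < e / 2)%R by rewrite divr_gt0.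
near=> n.
have FAB : F ((T n @^-1` A) `+` A) + F ((T n @^-1` B) `+` B) <= e%:E.
  rewrite [e in leRHS]splitr EFinD; apply: leeD.
    by near: n; exact: HA.
  by near: n; exact: HB.
apply: le_trans FAB; apply: le_measureU; try exact: measurable_symdiff.
  by apply: measurable_symdiff; exact: measurableU.
move=> x /= [[[Ax|Bx]]|[[Ax|Bx]]] /not_orP[nA nB].
- by left; left.
- by right; left.
- by left; right.
- by right; right.
Unshelve. all: by end_near. Qed.

(** A substitute for the invariance of [F] under the [T n]: they do not concentrate
    mass on small sets, uniformly for large [n]. *)
Hypothesis T_tight : forall E : nat -> set X, (forall m, measurable (E m)) ->
  nonincreasing_seq E -> \bigcap_m E m = set0 ->
  forall e : R, (0 < e)%R -> exists m, \forall n \near \oo, F (T n @^-1` E m) <= e%:E.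
Hypothesis F_fin : F setT < +oo.

Lemma asymptotically_invariant0 : asymptotically_invariant set0.
Proof.
split => // e e0; apply: nearW => n; rewrite preimage_set0 setYK measure0.
by rewrite lee_fin ltW.
Qed.

(** A finite union is invariant already, and the part [E m] that it leaves out is
    small both for [F] and, by tightness, for the images of [F]. *)
Lemma asymptotically_invariant_bigcup (A : nat -> set X) :
  (forall k, asymptotically_invariant (A k)) ->
  asymptotically_invariant (\bigcup_k A k).
Proof.
move=> HA; have mA k : measurable (A k) by have [] := HA k.
have mUA : measurable (\bigcup_k A k) by exact: bigcupT_measurable.
split => // e e0.
pose U m := \big[setU/set0]_(i < m) A i.
have HU m : asymptotically_invariant (U m).
  rewrite /U; elim: m => [|m IH]; first by rewrite big_ord0; exact: asymptotically_invariant0.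
  by rewrite big_ord_recr/=; exact: asymptotically_invariantU.
have mU m : measurable (U m) by have [] := HU m.
pose E m := (\bigcup_k A k) `\` U m.
have mE m : measurable (E m) by exact: measurableD.
have niE : nonincreasing_seq E.
  move=> m k mk; apply/subsetPset; apply: setDS.
  rewrite /U -!bigcup_mkord => x [i /= im Ax]; exists i => //=.
  exact: leq_trans mk.
have E0 : \bigcap_m E m = set0.
  rewrite -subset0 => x Ex; have [[k _ Akx] _] := Ex 0%N I.
  have [_] := Ex k.+1 I; apply; rewrite /U -bigcup_mkord; exists k => //=.
have e30 : (0 < e / 3)%R by rewrite divr_gt0.
have [m1 Hm1] := T_tight mE niE E0 e30.
have FE0 : F \o E @ \oo --> 0.
  rewrite -[X in _ --> X](measure0 F) -E0; apply: nonincreasing_cvg_mu => //.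
    by apply: le_lt_trans F_fin; apply: le_measure; rewrite ?inE.
  by rewrite E0.
have : \forall m \near \oo, F (E m) <= (e / 3)%:E.
  have /fine_cvgP[finF] := FE0.
  move=> /cvgrPdist_le /(_ _ e30) Hf.
  near=> m; have fm : F (E m) \is a fin_num by near: m.
  rewrite -(fineK fm) lee_fin; have : (`|0 - fine (F (E m))| <= e / 3)%R by near: m.
  by rewrite sub0r normrN ger0_norm// fine_ge0.
move=> [m2 _ Hm2]; pose m := maxn m1 m2.
have FEm : F (E m) <= (e / 3)%:E by apply: Hm2; exact: leq_maxr.
have FTE n : F (T n @^-1` E m1) <= (e / 3)%:E -> F (T n @^-1` E m) <= (e / 3)%:E.
  apply: le_trans; apply: le_measure; rewrite ?inE; try exact: mpre.
  by apply: preimage_subset; apply/subsetPset/niE; exact: leq_maxl.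
near=> n.
have HUn : F ((T n @^-1` U m) `+` U m) <= (e / 3)%:E.
  by near: n; have [_] := HU m; exact.
have HTn : F (T n @^-1` E m) <= (e / 3)%:E by apply: FTE; near: n.
apply: (@le_trans _ _ ((e / 3)%:E + (e / 3)%:E + (e / 3)%:E)); last first.
  by rewrite -!EFinD lee_fin; lra.
apply: (le_trans _ (leeD (leeD HUn HTn) FEm)).
apply: (le_trans _ (leeD (measureU2 _ (measurable_symdiff n (mU m)) (mpre n (mE m))) (lexx _))).
apply: le_measureU => //.
- by apply: measurableU; [exact: measurable_symdiff|exact: mpre].
- exact: measurable_symdiff.
have UA x : U m x -> (\bigcup_k A k) x.
  by rewrite /U -bigcup_mkord => -[k _ Akx]; exists k.
move=> x /= [[Tx nx]|[xA nTx]].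
  left; have [UTx|nUTx] := pselect (U m (T n x)); last by right; split.
  by left; left; split => // /UA.
have [Ux|nUx] := pselect (U m x); last by right; split.
by left; left; right; split => // /UA.
Unshelve. all: by end_near. Qed.

Lemma sigma_algebra_asymptotically_invariant :
  sigma_algebra setT asymptotically_invariant.
Proof.
split.
- exact: asymptotically_invariant0.
- by move=> A; rewrite setTD; exact: asymptotically_invariantC.
- exact: asymptotically_invariant_bigcup.
Qed.

(** When [x] and [T n x] lie in the same level set [A k] of height [del], the values
    of [f] differ by at most [del]; otherwise [x] lies in the symmetric difference
    [B n k], whose mass vanishes.  Boundedness leaves finitely many [k]. *)
Lemma asymptotically_invariant_integral (f : X -> R) (M : R) :
  F setT = 1 -> (forall A, measurable A -> asymptotically_invariant A) ->
  measurable_fun setT f -> (forall x, (0 <= f x <= M)%R) ->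
  \int[F]_x `|f (T n x) - f x|%:E @[n --> \oo] --> 0.
Proof.
move=> F1 inv mf fM.
have mfT n : measurable_fun setT (fun x => `|f (T n x) - f x|%:E).
  apply/measurable_EFinP; apply: measurableT_comp => //.
  by apply: measurable_funB => //; exact: measurableT_comp.
suff Hlim : forall e : R, (0 < e)%R ->
    \forall n \near \oo, \int[F]_x `|f (T n x) - f x|%:E <= e%:E.
  apply/fine_cvgP; split.
    have := Hlim 1%R ltr01; apply: filterS => n Hn.
    by rewrite ge0_fin_numE ?integral_ge0// (le_lt_trans Hn)// ltry.
  apply/cvgrPdist_le => e e0; have := Hlim e e0; apply: filterS => n Hn.
  have I0 : 0 <= \int[F]_x `|f (T n x) - f x|%:E by exact: integral_ge0.
  rewrite sub0r normrN ger0_norm ?fine_ge0// -lee_fin fineK//.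
  by rewrite ge0_fin_numE// (le_lt_trans Hn)// ltry.
move=> e e0.
have M0 : (0 <= M)%R by have /andP[] := fM point; exact: le_trans.
pose del := (e / 2)%R; have del0 : (0 < del)%R by rewrite divr_gt0.
have [K MK] : exists K : nat, (M < K%:R * del)%R.
  exists (Num.truncn (M / del)).+1; rewrite -ltr_pdivrMr//.
  exact: truncnS_gt.
pose A (k : nat) := f @^-1` `[(k%:R * del)%R, (k.+1%:R * del)%R[%classic.
have mA k : measurable (A k) by rewrite -[X in measurable X]setTI; exact: mf.
pose B n k := (T n @^-1` A k) `+` A k.
have mB n k : measurable (B n k) by exact: measurable_symdiff.
have bound n x : (`|f (T n x) - f x| <= del + M * \sum_(k < K) \1_(B n k) x)%R.
  pose k := Num.truncn (f x / del).
  have /andP[fx0 fxM] := fM x.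
  have kx : A k x.
    rewrite /A /= in_itv/=; have /andP[h1 h2] := truncn_itv (divr_ge0 fx0 (ltW del0)).
    by rewrite -ler_pdivlMr// h1 -ltr_pdivrMr.
  have kK : (k < K)%N.
    rewrite -(ltr_nat R) -(ltr_pM2r del0); apply: le_lt_trans MK.
    by apply: le_trans fxM; move: kx; rewrite /A/= in_itv/= => /andP[].
  have sum0 : (0 <= \sum_(k < K) (\1_(B n k) x : R))%R.
    by apply: sumr_ge0 => i _; rewrite indicE.
  have [kTx|nkTx] := pselect (A k (T n x)).
    rewrite (@le_trans _ _ del)// ?lerDl ?mulr_ge0//.
    move: kx kTx; rewrite /A/= !in_itv/= -natr1 mulrDl mul1r.
    move=> /andP[? ?] /andP[? ?]; rewrite ler_distl; apply/andP; split; lra.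
  have /andP[fT0 fTM] := fM (T n x).
  rewrite (@le_trans _ _ M)//.
    by rewrite ler_distl; apply/andP; split; lra.
  rewrite ler_wpDl ?(ltW del0)// ler_peMr// (bigD1 (Ordinal kK))//=.
  rewrite indicE mem_set/=; last by right.
  by rewrite lerDl sumr_ge0// => i _; rewrite indicE.
have intbound n : \int[F]_x `|f (T n x) - f x|%:E <=
    del%:E + M%:E * \sum_(k < K) F (B n k).
  have mind k : measurable_fun setT (fun x => (\1_(B n k) x : R)%:E).
    by apply/measurable_EFinP; exact: measurable_indic.
  apply: (@le_trans _ _ (\int[F]_x (del%:E + M%:E * \sum_(k < K) (\1_(B n k) x)%:E))).
    apply: ge0_le_integral => //.
    - apply: emeasurable_funD => //; apply: measurable_funeM.
      by apply: emeasurable_sum => k; exact: mind.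
    - by move=> x _; rewrite sumEFin -EFinM -EFinD lee_fin; exact: bound.
  have sum_ge0 x : 0 <= \sum_(k < K) (\1_(B n k) x : R)%:E.
    by apply: sume_ge0 => k _; rewrite lee_fin indicE.
  have msum : measurable_fun setT (fun x => \sum_(k < K) (\1_(B n k) x : R)%:E).
    by apply: emeasurable_sum => k; exact: mind.
  have Msum0 x : setT x -> 0 <= M%:E * \sum_(k < K) (\1_(B n k) x : R)%:E.
    by move=> _; rewrite mule_ge0.
  have mMsum : measurable_fun setT
      (fun x => M%:E * \sum_(k < K) (\1_(B n k) x : R)%:E).
    exact: measurable_funeM.
  have del0E : 0 <= del%:E by rewrite lee_fin ltW.
  rewrite ge0_integralD//.
  rewrite integral_cst// F1 mule1 ge0_integralZl// ge0_integral_sum//.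
  rewrite leeD2l// lee_wpmul2l ?lee_fin//.
  by apply: lee_sum => k _; rewrite integral_indic// setIT.
(* The [K] exceptional sets of mass [eta] contribute [M * K * eta <= del]. *)
pose eta := (del / (M * K%:R + 1))%R.
have MK0 : (0 < M * K%:R + 1)%R by rewrite ltr_wpDl// mulr_ge0.
have eta0 : (0 < eta)%R by rewrite divr_gt0.
near=> n.
have HB (k : 'I_K) : F (B n k) <= eta%:E.
  move: k; near: n; apply: filter_forall => k.
  by have [_] := inv _ (mA k); exact.
apply: (le_trans (intbound n)).
apply: (@le_trans _ _ (del%:E + M%:E * \sum_(k < K) eta%:E)).
  by rewrite leeD2l// lee_wpmul2l ?lee_fin//; apply: lee_sum => k _; exact: HB.
rewrite sumEFin -EFinM -EFinD lee_fin sumr_const card_ord.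
rewrite [leRHS]splitr -/del lerD2l -[X in (_ * X)%R]mulr_natl mulrA.
rewrite /eta mulrA ler_pdivrMr// [leRHS]mulrC ler_wpM2r ?(ltW del0)//.
by rewrite lerDl.
Unshelve. all: by end_near. Qed.

End asymptotic_invariance.

Lemma cvge0_le {R : realType} (u : nat -> \bar R) (e : R) :
  u @ \oo --> 0%E -> (forall n, 0 <= u n)%E -> 0 < e ->
  \forall n \near \oo, (u n <= e%:E)%E.
Proof.
move=> /fine_cvgP[finu /cvgrPdist_le H] u0 e0.
near=> n; have fu : u n \is a fin_num by near: n.
rewrite -(fineK fu) lee_fin; have : `|0 - fine (u n)| <= e by near: n; exact: H.
by rewrite sub0r normrN ger0_norm// fine_ge0.
Unshelve. all: by end_near. Qed.

Section translation.
Local Open Scope ereal_scope.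
Context {R : realType} {d : nat}.
Variables (F : probability (euclid R d) R) (f : euclid R d -> R) (M : R).
Hypothesis mf : measurable_fun setT f.
Hypothesis fM : forall x, (0 <= f x <= M)%R.
Hypothesis FE : forall A, measurable A -> F A = \int[lebesgue_tuple]_(x in A) (f x)%:E.
Variables (r : nat -> R) (y : euclid R d).
Hypothesis r0 : r @ \oo --> (0 : R)%R.

Lemma homothetyE (x : euclid R d) (rho : R) z :
  homothety x rho z = homothety (homothety origin rho z) 1 x.
Proof.
by apply/eq_from_tnth => i; rewrite !tnth_mktuple mul1r add0r addrC.
Qed.

Let T n (x : euclid R d) := homothety x (r n) y.

Let mT n : measurable_fun setT (T n).
Proof.
rewrite (_ : T n = homothety (homothety origin (r n) y) 1).
  exact: measurable_homothety.
by apply/funext => x; rewrite /T homothetyE.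
Qed.

Let lebesgue_T n A : measurable A -> lebesgue_tuple (T n @^-1` A) = lebesgue_tuple A.
Proof.
move=> mA; have mTA : measurable (T n @^-1` A).
  by rewrite -[X in measurable X]setTI; exact: mT.
have indE (B : set (euclid R d)) : measurable B ->
    lebesgue_tuple B = \int[lebesgue_tuple]_x (\1_B x : R)%:E.
  by move=> mB; rewrite integral_indic// setIT.
rewrite (indE _ mTA) (indE _ mA).
rewrite [RHS](lebesgue_tuple_homothety (homothety origin (r n) y) ltr01)//.
  apply: eq_integral => x _; rewrite expr1n mul1e.
  by rewrite /T; congr (_%:E); rewrite !indicE -homothetyE; congr (_%:R).
by apply/measurable_EFinP; exact: measurable_indic.
Qed.

Let F_le A : measurable A -> F A <= M%:E * lebesgue_tuple A.
Proof.
move=> mA; rewrite FE// -integral_cst//; apply: ge0_le_integral => //.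
- by move=> x _; rewrite lee_fin; have /andP[] := fM x.
- by apply: measurable_funTS; exact/measurable_EFinP.
- by move=> x _; rewrite lee_fin; have /andP[] := fM x.
Qed.

Let cube_nd (a b : R) : (a <= b)%R -> cube a `<=` @cube R d b.
Proof.
move=> ab x xa i; have := xa i; rewrite /= !in_itv/= => /andP[h1 h2].
by rewrite (le_trans h2 ab) andbT (le_trans _ h1)// lerN2.
Qed.

Let cube_exhaust : \bigcup_k @cube R d k%:R = setT.
Proof.
rewrite -subTset => x _.
pose N := (\max_(i < d) (Num.truncn `|tnth x i : R|%R).+1)%N.
exists N => // i; rewrite /= in_itv/= -ler_norml.
apply: (@le_trans _ _ ((Num.truncn `|tnth x i : R|%R).+1)%:R).
  by apply: ltW; exact: truncnS_gt.
rewrite ler_nat; exact: (leq_bigmax_cond (F := fun i => (Num.truncn `|tnth x i : R|%R).+1)).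
Qed.

Let cube_tail (e : R) : (0 < e)%R -> exists k : nat, F (~` cube k%:R) <= e%:E.
Proof.
move=> e0; have mC k : measurable (~` @cube R d k%:R).
  by apply: measurableC; exact: measurable_cube.
have cvg0 : F \o (fun k : nat => ~` cube k%:R) @ \oo --> 0.
  have E0 : \bigcap_k (~` @cube R d k%:R) = set0.
    by rewrite -setC_bigcup cube_exhaust setCT.
  rewrite -[X in _ --> X](measure0 F) -E0; apply: nonincreasing_cvg_mu => //.
  - by rewrite (le_lt_trans (probability_le1 _ _))// ltry.
  - by rewrite E0.
  - move=> k l kl; apply/subsetPset/subsetC/cube_nd; rewrite ler_nat//.
have [//|k _ Hk] := cvge0_le cvg0 _ e0; last by exists k; apply: Hk => /=.
Qed.

Let r_small : \forall n \near \oo, forall i, (`|r n * tnth y i| <= 1)%R.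
Proof.
have H (i : 'I_d) : \forall n \near \oo, (`|r n * tnth y i| <= 1)%R.
  have c0 : (0 < (`|tnth y i : R| + 1)^-1)%R by rewrite invr_gt0 ltr_wpDl.
  have := r0 => /cvgrPdist_le /(_ _ c0); apply: filterS => n.
  rewrite sub0r normrN normrM => Hr.
  apply: (@le_trans _ _ ((`|tnth y i : R| + 1)^-1 * `|tnth y i : R|))%R.
    by rewrite ler_wpM2r.
  by rewrite mulrC ler_pdivrMr ?ltr_wpDl// mul1r lerDl.
exact: filter_forall.
Qed.

(** Up to a small mass, [x] lies in a fixed cube, and then [T n x] lies in a
    slightly larger one.  In that cube the volumes of the sets [E m] tend to [0],
    translations preserve them, and the bound [M] on the density controls [F]. *)
Let T_tight (E : nat -> set (euclid R d)) : (forall m, measurable (E m)) ->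
  nonincreasing_seq E -> \bigcap_m E m = set0 ->
  forall e : R, (0 < e)%R -> exists m, \forall n \near \oo, F (T n @^-1` E m) <= e%:E.
Proof.
move=> mE niE E0 e e0; have e20 : (0 < e / 2)%R by rewrite divr_gt0.
have M0 : (0 <= M)%R by have /andP[] := fM point; exact: le_trans.
have [a Ha] := cube_tail e20.
pose D m := E m `&` cube a.+1%:R.
have mD m : measurable (D m) by apply: measurableI => //; exact: measurable_cube.
have D0 : \bigcap_m D m = set0.
  by rewrite -subset0 -E0 => x Dx m _; have [] := Dx m I.
have cvgD : lebesgue_tuple \o D @ \oo --> 0.
  rewrite [X in _ --> X](_ : _ = lebesgue_tuple (\bigcap_m D m)); last first.
    by rewrite D0 measure0.
  apply: nonincreasing_cvg_mu => //.
  - apply: (@le_lt_trans _ _ (lebesgue_tuple (@cube R d a.+1%:R))).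
      apply: le_measure; rewrite ?inE//; first exact: measurable_cube.
      by move=> x [].
    by rewrite lebesgue_cube// ltry.
  - by rewrite D0.
  - by move=> m k mk; apply/subsetPset; apply: setSI; apply/subsetPset/niE.
have eta0 : (0 < e / 2 / (M + 1))%R by rewrite divr_gt0// ltr_wpDl.
have [//|m _ Hm] := cvge0_le cvgD _ eta0.
exists m; have := r_small; apply: filterS => n rn.
have mTE A : measurable A -> measurable (T n @^-1` A).
  by move=> mA; rewrite -[X in measurable X]setTI; exact: mT.
have mcube := measurableC (@measurable_cube R d a%:R).
have sub : T n @^-1` E m `<=` ~` cube a%:R `|` T n @^-1` D m.
  move=> x /= Ex; have [xa|nxa] := pselect (cube a%:R x); last by left.
  right; split => // i; have := xa i; have := rn i.
  rewrite /= !in_itv/= tnth_mktuple -natr1 ler_norml => /andP[? ?] /andP[? ?].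
  by apply/andP; split; lra.
apply: (@le_trans _ _ (F (~` cube a%:R `|` T n @^-1` D m))).
  apply: le_measure; rewrite ?inE//; first exact: mTE.
  by apply: measurableU => //; exact: mTE.
apply: (le_trans (measureU2 _ mcube (mTE _ (mD m)))).
rewrite [e in leRHS]splitr EFinD; apply: leeD => //.
apply: (le_trans (F_le (mTE _ (mD m)))).
rewrite [X in _ * X](lebesgue_T n (mD m)).
apply: (@le_trans _ _ (M%:E * (e / 2 / (M + 1))%:E)).
  by rewrite lee_wpmul2l ?lee_fin//; exact: (Hm m (leqnn m)).
rewrite -EFinM lee_fin mulrA ler_pdivrMr ?ltr_wpDl// mulrC.
by rewrite ler_wpM2l ?(ltW e20)// lerDl.
Qed.

Let F_hyperplane i (c : R) : F [set x : euclid R d | tnth x i = c] = 0.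
Proof.
have mH : measurable [set x : euclid R d | tnth x i = c].
  rewrite (_ : [set x | _] = (fun x : euclid R d => tnth x i) @^-1` [set c])//.
  rewrite -[X in measurable X]setTI; apply: (measurable_tnth i) => //.
apply/eqP; rewrite eq_le measure_ge0 andbT (le_trans (F_le mH))//.
rewrite (_ : [set x | _] = [set x : euclid R d |
    forall k, (if k == i then [set c] else setT) (tnth x k)]); last first.
  apply/seteqP; split => x /= Hx; last by have := Hx i; rewrite eqxx.
  by move=> k; case: eqP => [->|].
rewrite [X in _ * X](_ : _ = 0) ?mule0//.
transitivity (\prod_(k < d) lebesgue_measure (if k == i then [set c] else setT : set R)).
  apply: (tuple_measure_box lebesgue_measure
    (B := fun k => if k == i then [set c] else setT)) => k.
  by case: ifP => _.
by rewrite (bigD1 i)//= eqxx lebesgue_measure_set1 mul0e.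
Qed.

(** The sets of points separated from their translates by a hyperplane lie
    in slabs that shrink to it, and hyperplanes are null sets. *)
Let invariant_slab i (c : R) :
  asymptotically_invariant F T [set x : euclid R d | (c < tnth x i)%R].
Proof.
have mS (a : R) : measurable [set x : euclid R d | (a < tnth x i)%R].
  rewrite -[X in measurable X]setTI -preimage_itvoy.
  by apply: (measurable_tnth i) => //; exact: measurable_itv.
split=> // e e0.
pose E (k : nat) := [set x : euclid R d | (c - k.+1%:R^-1 <= tnth x i <= c + k.+1%:R^-1)%R].
have mE k : measurable (E k).
  rewrite (_ : E k = (fun x : euclid R d => tnth x i) @^-1`
      `[(c - k.+1%:R^-1)%R, (c + k.+1%:R^-1)%R]).
    rewrite -[X in measurable X]setTI.
    by apply: (measurable_tnth i) => //; exact: measurable_itv.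
  by apply/seteqP; split => x /=; rewrite in_itv.
have cvgE : F \o E @ \oo --> 0.
  have E0 : \bigcap_k E k = [set x : euclid R d | tnth x i = c].
    apply/seteqP; split => x /=.
      move=> Ex; apply/eqP; rewrite eq_le; apply/andP; split.
        apply/ler_addgt0Pr => eps eps0; near \oo => k.
        have /andP[_ xk] := Ex k I; apply: (le_trans xk); rewrite lerD2l ltW//.
        by near: k; exact: near_infty_natSinv_lt (PosNum eps0).
      apply/ler_addgt0Pr => eps eps0; near \oo => k.
      have /andP[xk _] := Ex k I; rewrite -lerBlDr; apply: le_trans xk.
      rewrite lerD2l lerN2 ltW//.
      by near: k; exact: near_infty_natSinv_lt (PosNum eps0).
    by move=> xc k _; rewrite /E/= xc lerBlDr !lerDl !invr_ge0 !ler0n.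
  rewrite -[X in _ --> X](F_hyperplane i c) -E0; apply: nonincreasing_cvg_mu => //.
  - by rewrite (le_lt_trans (probability_le1 _ _))// ltry.
  - exact: bigcapT_measurable.
  - move=> k l kl; apply/subsetPset => x /= /andP[h1 h2].
    have H : (l.+1%:R^-1 <= k.+1%:R^-1 :> R)%R by rewrite lef_pV2 ?posrE// ler_nat.
    by apply/andP; split; [apply: le_trans h1|apply: (le_trans h2)];
      rewrite lerD2l// lerN2.
have [//|k _ Hk] := cvge0_le cvgE _ e0.
have : \forall n \near \oo, (`|r n * tnth y i| <= k.+1%:R^-1)%R.
  have c0 : (0 < k.+1%:R^-1 / (`|tnth y i : R| + 1))%R.
    by rewrite divr_gt0 ?invr_gt0// ltr_wpDl.
  have := r0 => /cvgrPdist_le /(_ _ c0); apply: filterS => n.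
  rewrite sub0r normrN normrM => Hr.
  apply: (@le_trans _ _ (k.+1%:R^-1 / (`|tnth y i : R| + 1) * `|tnth y i : R|))%R.
    by rewrite ler_wpM2r.
  rewrite -mulrA ler_piMr ?invr_ge0//.
  by rewrite mulrC ler_pdivrMr ?ltr_wpDl// mul1r lerDl.
apply: filterS => n Hn; apply: le_trans (Hk k (leqnn k)).
have mTS : measurable (T n @^-1` [set x : euclid R d | (c < tnth x i)%R]).
  by rewrite -[X in measurable X]setTI; exact: mT.
apply: le_measure; rewrite ?inE//.
  by apply: measurableU; apply: measurableD.
move: Hn; rewrite ler_norml => Hn.
have close (a b e' : R) : (- e' <= b <= e')%R -> (c < a + b)%R != (c < a)%R ->
    (c - e' <= a <= c + e')%R.
  move=> /andP[? ?]; have [? | ?] := ltP c (a + b)%R; have [? | ?] := ltP c a => // _;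
  by apply/andP; split; lra.
move=> x /= Hx; apply: (close _ _ _ Hn).
by case: Hx => -[]; rewrite /T tnth_mktuple => u1 /negP/negbTE ->; rewrite u1.
Unshelve. all: by end_near. Qed.

Lemma translates_asymptotically_invariant A :
  measurable A -> asymptotically_invariant F T A.
Proof.
have sigma : sigma_algebra setT (asymptotically_invariant F T).
  apply: sigma_algebra_asymptotically_invariant => //.
  by rewrite (le_lt_trans (probability_le1 _ _))// ltry.
have [s0 sC sU] := sigma.
move: A; apply: smallest_sub => //.
move=> B; rewrite -bigcup_seq/= => -[i _ [C mC <-]]; rewrite setTI.
have {mC} : (@RGenOInfty.G R).-sigma.-measurable C by rewrite -RGenOInfty.measurableE.
move: C; apply: smallest_sub => [|_ [c ->]]; last first.
  have := invariant_slab i c; congr (asymptotically_invariant _ _ _).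
  by rewrite -preimage_itvoy.
split.
- by rewrite /= preimage_set0.
- by move=> C HC; rewrite /= setTD -preimage_setC -setTD; exact: sC.
- by move=> C HC; rewrite /= preimage_bigcup; exact: sU.
Qed.

(** For continuous densities this would be dominated convergence; a general one is
    close to its translates only on average. *)
Lemma translates_cvg :
  \int[F]_x `|f (homothety x (r n) y) - f x|%:E @[n --> \oo] --> 0.
Proof.
apply: (@asymptotically_invariant_integral _ _ _ F T _ f M) => //.
  exact: probability_setT.
exact: translates_asymptotically_invariant.
Qed.

End translation.

(** * Small simplices and the moments of the density *)

(** Replacing one factor by [b] changes the product by [`|a i - b|] times [n - 1]
    factors of size at most [c]; the factors are replaced in turn. *)
Lemma ler_norm_prodB {R : realDomainType} (c : R) n (a : 'I_n -> R) (b : R) :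
  1 <= c -> (forall i, 0 <= a i <= c) -> 0 <= b <= c ->
  `|\prod_(i < n) a i - b ^+ n| <= c ^+ n * \sum_(i < n) `|a i - b|.
Proof.
move=> c1 + /andP[b0 bc]; have c0 : 0 <= c by exact: le_trans c1.
elim: n a => [|n IH] a ac.
  by rewrite !big_ord0 expr0 subrr normr0 mulr0.
rewrite !big_ord_recl exprS.
set p := \prod_(i < n) _; set s := \sum_(i < n) _.
have -> : a ord0 * p - b * b ^+ n = (a ord0 - b) * p + b * (p - b ^+ n) by ring.
apply: (le_trans (ler_normD _ _)); rewrite !normrM mulrDr; apply: lerD.
  rewrite mulrC ler_wpM2r// ger0_norm; last first.
    by apply: prodr_ge0 => i _; have /andP[] := ac (lift ord0 i).
  apply: (@le_trans _ _ (c ^+ n)).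
    rewrite -[n in leRHS]card_ord -prodr_const; apply: ler_prod => i _; exact: ac.
  by rewrite exprS ler_peMl// exprn_ge0.
rewrite exprS -mulrA ger0_norm// ler_pM//.
by apply: IH => i; exact: ac.
Qed.

Section simplex_probability.
Local Open Scope ereal_scope.
Context {R : realType} {d : nat}.
Variables (F : probability (euclid R d) R) (f : euclid R d -> R) (M : R).
Hypothesis Ff : bounded_density F f.
Hypothesis fM : forall x, (f x <= M)%R.

Let mf : measurable_fun setT f. Proof. by have [] := Ff. Qed.
Let f0 x : (0 <= f x)%R. Proof. by have [_ + _ _] := Ff; exact. Qed.
Let M0 : (0 <= M)%R. Proof. exact: le_trans (f0 point) (fM point). Qed.

Definition simplex_prob j (r : R) : R :=
  \int[tuple_measure F j.+1]_t (meeting_balls r t)%:R.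

Definition density_moment j : R := \int[F]_x f x ^+ j.

(** The density of the other points of a simplex with a vertex at [x], in the
    coordinates of [homothety x r]. *)
Definition local_product j (r : R) (x : euclid R d) (t : j.-tuple (euclid R d)) : R :=
  \prod_(i < j) f (homothety x r (tnth t i)).

Lemma local_product_ge0 j r x (t : j.-tuple (euclid R d)) :
  (0 <= local_product r x t)%R.
Proof. exact: prodr_ge0. Qed.

Lemma local_product_le j r x (t : j.-tuple (euclid R d)) :
  (local_product r x t <= M ^+ j)%R.
Proof.
rewrite -[j in leRHS]card_ord -prodr_const; apply: ler_prod => i _.
by rewrite f0 fM.
Qed.

Lemma measurable_local_product j r :
  measurable_fun setT (fun z : euclid R d * j.-tuple (euclid R d) =>
    local_product r z.1 z.2).
Proof.
apply: measurable_prod => i _; apply: (measurableT_comp mf).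
apply/measurable_fun_tnthP => k.
rewrite (_ : _ \o _ = fun z : euclid R d * j.-tuple (euclid R d) =>
    ((tnth z.1 k : R) + r * tnth (tnth z.2 i) k)%R); last first.
  by apply/funext => z /=; rewrite tnth_mktuple.
apply: measurable_funD.
  exact: (measurableT_comp (measurable_tnth k) measurable_fst).
apply: measurable_funM => //.
apply: (measurableT_comp (measurable_tnth k)).
exact: (measurableT_comp (measurable_tnth i) measurable_snd).
Qed.

Let mean_local_product j r (t : j.-tuple (euclid R d)) : \bar R :=
  \int[F]_x (local_product r x t)%:E.

Let mean_local_product_ge0 j r (t : j.-tuple (euclid R d)) :
  0 <= mean_local_product r t.
Proof. by apply: integral_ge0 => x _; rewrite lee_fin local_product_ge0. Qed.

Let mlp1 j r (t : j.-tuple (euclid R d)) :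
  measurable_fun setT (fun x => local_product r x t).
Proof.
rewrite (_ : (fun x => _) = (fun z : euclid R d * j.-tuple (euclid R d) =>
    local_product r z.1 z.2) \o pair^~ t)//.
by apply: measurableT_comp => //; exact: measurable_local_product.
Qed.

Let mean_local_product_le j r (t : j.-tuple (euclid R d)) :
  mean_local_product r t <= (M ^+ j)%:E.
Proof.
rewrite -[leRHS]mule1 -(probability_setT F) -integral_cst//.
apply: ge0_le_integral => //.
- by move=> x _; rewrite lee_fin local_product_ge0.
- exact/measurable_EFinP.
- by move=> x _; rewrite lee_fin local_product_le.
Qed.

Let measurable_mean_local_product j r :
  measurable_fun setT (@mean_local_product j r).
Proof.
apply: (measurable_fun_fubini_tonelli_G (m1 := F)
  (fun z : euclid R d * j.-tuple (euclid R d) => (local_product r z.1 z.2)%:E)).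
  by apply/measurable_EFinP; exact: measurable_local_product.
by move=> z; rewrite lee_fin local_product_ge0.
Qed.

(** The integration over the vertex [x] is performed first: the configuration [t]
    of the other vertices is then the same for all [x] and all radii, and the
    convergence of translates applies for each [t]. *)
Let rescaled j r : \bar R :=
  \int[tuple_measure lebesgue_tuple j]_t ((cech_link t)%:E * mean_local_product r t).

Let mrescaled j r : measurable_fun setT
  (fun t : j.-tuple (euclid R d) => (cech_link t)%:E * mean_local_product r t).
Proof.
apply: emeasurable_funM; last exact: measurable_mean_local_product.
by apply/measurable_EFinP; exact: measurable_cech_link.
Qed.

Let cech_link_ge0 j (t : j.-tuple (euclid R d)) : (0 <= cech_link t)%R.
Proof. by have /andP[] := cech_link01 t. Qed.

Let rescaled_le j r : rescaled j r <= (M ^+ j * cech_volume d j)%:E.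
Proof.
rewrite EFinM EFin_cech_volume -ge0_integralZl//; last 3 first.
- by apply/measurable_EFinP; exact: measurable_cech_link.
- by move=> t _; rewrite lee_fin.
- by rewrite lee_fin exprn_ge0.
apply: ge0_le_integral => //.
- by move=> t _; rewrite mule_ge0// lee_fin.
- exact: mrescaled.
- by apply: measurable_funeM; apply/measurable_EFinP; exact: measurable_cech_link.
- by move=> t _; rewrite muleC lee_wpmul2r// lee_fin.
Qed.

Let rescaled_ge0 j r : 0 <= rescaled j r.
Proof. by apply: integral_ge0 => t _; rewrite mule_ge0// lee_fin. Qed.

Let integral_simplexE j r : (0 < r)%R ->
  \int[tuple_measure F j.+1]_t ((meeting_balls r t)%:R)%:E =
  ((r ^+ d) ^+ j)%:E * rescaled j r.
Proof.
move=> r0; have mmb := @measurable_meeting_balls R d r j.+1 (ltW r0).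
have mmbE : measurable_fun setT
    (fun t : j.+1.-tuple (euclid R d) => ((meeting_balls r t)%:R : R)%:E).
  exact/measurable_EFinP.
rewrite ge0_integral_tupleS//.
transitivity (\int[F]_x \int[tuple_measure lebesgue_tuple j]_t
   (((r ^+ d) ^+ j)%:E * ((cech_link t)%:E * (local_product r x t)%:E))).
  apply: eq_integral => x _.
  rewrite (sample_homothety x Ff r0)//; last exact: (measurable_tuple_cons_section x mmbE).
  apply: eq_integral => t _; rewrite big_split/= prodr_const card_ord.
  rewrite EFinM -muleA; congr (_ * _); rewrite muleC; congr (_ * _).
  rewrite /cech_link -(meeting_balls_homothety x _ r0); congr (_%:E); congr (_%:R).
  congr nat_of_bool; congr (meeting_balls r (_ :: _)).
  by rewrite [LHS](seq.map_comp (homothety x r) (tnth t)) map_tnth_enum.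
rewrite (fubini_tonelli (fun z : euclid R d * j.-tuple (euclid R d) =>
    ((r ^+ d) ^+ j)%:E * ((cech_link z.2)%:E * (local_product r z.1 z.2)%:E))); last 2 first.
- apply: measurable_funeM; apply: emeasurable_funM; apply/measurable_EFinP.
    exact: (measurableT_comp (@measurable_cech_link R d j) measurable_snd).
  exact: measurable_local_product.
- by move=> z; rewrite -!EFinM lee_fin !mulr_ge0// ?exprn_ge0// ?local_product_ge0// ltW.
rewrite -ge0_integralZl//; last 3 first.
- exact: mrescaled.
- by move=> t _; rewrite mule_ge0// lee_fin.
- by rewrite lee_fin !exprn_ge0// ltW.
apply: eq_integral => t _ /=.
rewrite ge0_integralZl//; last 3 first.
- by apply: measurable_funeM; exact/measurable_EFinP.
- by move=> x _; rewrite -EFinM lee_fin mulr_ge0// local_product_ge0.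
- by rewrite lee_fin !exprn_ge0// ltW.
congr (_ * _); rewrite ge0_integralZl//.
- exact/measurable_EFinP.
- by move=> x _; rewrite lee_fin local_product_ge0.
- by rewrite lee_fin.
Qed.

Let rescaled_fin j r : rescaled j r \is a fin_num.
Proof. by rewrite ge0_fin_numE// (le_lt_trans (rescaled_le j r))// ltry. Qed.

Lemma simplex_probE j r : (0 < r)%R ->
  simplex_prob j r = ((r ^+ d) ^+ j * fine (rescaled j r))%R.
Proof.
by move=> r0; rewrite /simplex_prob /Rintegral integral_simplexE// fineM.
Qed.

Lemma simplex_prob_ge0 j r : (0 <= simplex_prob j r)%R.
Proof. by apply: fine_ge0; apply: integral_ge0 => t _; rewrite lee_fin. Qed.

Lemma simplex_prob_le j r : (0 < r)%R ->
  (simplex_prob j r <= (r ^+ d * (M * 4 ^+ d)) ^+ j)%R.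
Proof.
move=> r0; rewrite simplex_probE// [leRHS]exprMn ler_wpM2l ?exprn_ge0 ?(ltW r0)//.
rewrite exprMn -lee_fin fineK//; apply: (le_trans (rescaled_le j r)).
by rewrite lee_fin ler_wpM2l ?exprn_ge0//; exact: cech_volume_le.
Qed.

Let density_moment_integrable j : F.-integrable setT (EFin \o (fun x => f x ^+ j)%R).
Proof.
apply: (bounded_integrable_prob (M := (M ^+ j)%R)).
- exact: probability_setT.
- exact: measurable_funX.
- by move=> x; rewrite ger0_norm ?exprn_ge0// lerXn2r ?nnegrE.
Qed.

Let local_product_integrable j r (t : j.-tuple (euclid R d)) :
  F.-integrable setT (EFin \o (fun x => local_product r x t)%R).
Proof.
apply: (bounded_integrable_prob (M := (M ^+ j)%R)) => //.
- exact: probability_setT.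
- by move=> x; rewrite ger0_norm ?local_product_ge0// local_product_le.
Qed.

(** The factors [f (x + r n * t_i)] all tend to [f x] in the mean, hence so does
    their product to [f x ^+ j], all of them being bounded. *)
Lemma mean_local_product_cvg j (r : nat -> R) (t : j.-tuple (euclid R d)) :
  r @ \oo --> (0 : R)%R ->
  mean_local_product (r n) t @[n --> \oo] --> (density_moment j)%:E.
Proof.
move=> r0; pose c := (M + 1)%R.
have c1 : (1 <= c)%R by rewrite lerDr.
have fc x : (0 <= f x <= c)%R by rewrite f0/= (le_trans (fM x))// lerDl.
have fM' x : (0 <= f x <= M)%R by rewrite f0 fM.
have FE : forall A, measurable A -> F A = \int[lebesgue_tuple]_(x in A) (f x)%:E.
  by have [] := Ff.
have Hi (i : 'I_j) := translates_cvg mf fM' FE (tnth t i) r0.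
have msh n (i : 'I_j) : measurable_fun setT
    (fun x => `|f (homothety x (r n) (tnth t i)) - f x|%:E).
  apply/measurable_EFinP; apply: measurableT_comp => //; apply: measurable_funB => //.
  apply: (measurableT_comp mf).
  rewrite (_ : (fun x => _) = homothety (homothety origin (r n) (tnth t i)) 1).
    exact: measurable_homothety.
  by apply/funext => x; rewrite homothetyE.
have -> : (density_moment j)%:E = \int[F]_x (f x ^+ j)%:E.
  by rewrite /density_moment /Rintegral fineK//;
    exact: (integrable_fin_num measurableT (density_moment_integrable j)).
apply/sube_cvg0.
  exact: (integrable_fin_num measurableT (density_moment_integrable j)).
apply/cvg_abse0P.
apply: (@squeeze_cvge _ _ _ _ (cst 0) _ (fun n => (c ^+ j)%:E *
  \sum_(i < j) \int[F]_x `|f (homothety x (r n) (tnth t i)) - f x|%:E)).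
- apply: nearW => n; rewrite abse_ge0/=.
  rewrite /mean_local_product -integralB//; last 2 first.
  + exact: local_product_integrable.
  + exact: density_moment_integrable.
  apply: (le_trans (le_abse_integral _ _ _)) => //.
    apply/measurable_EFinP/measurable_funB => //; exact: measurable_funX.
  rewrite -ge0_integral_sum// -ge0_integralZl//; last 3 first.
  + by apply: emeasurable_sum => i; exact: msh.
  + by move=> x _; apply: sume_ge0.
  + by rewrite lee_fin exprn_ge0// (le_trans _ c1).
  apply: ge0_le_integral => //.
  + apply/measurable_EFinP; apply: measurableT_comp => //.
    by apply: measurable_funB => //; exact: measurable_funX.
  + by apply: measurable_funeM; apply: emeasurable_sum => i; exact: msh.
  + move=> x _; rewrite sumEFin -EFinM lee_fin.
    exact: ler_norm_prodB.
- exact: cvg_cst.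
- rewrite [X in _ --> X](_ : _ = (c ^+ j)%:E * \sum_(i < j) 0); last first.
    by rewrite big1 ?mule0.
  apply: cvgeZl => //; apply: cvg_nnesum => // i _.
  by apply: nearW => n; apply: integral_ge0.
Qed.

Lemma simplex_prob_cvg j (r : nat -> R) : (forall n, (0 < r n)%R) ->
  r @ \oo --> (0 : R)%R ->
  (simplex_prob j (r n) / (r n ^+ d) ^+ j)%R @[n --> \oo] -->
  (cech_volume d j * density_moment j)%R.
Proof.
move=> rgt0 r0.
rewrite (_ : (fun n => _) = (fun n => fine (rescaled j (r n)))); last first.
  apply/funext => n; rewrite simplex_probE// mulrAC divff ?mul1r//.
  by rewrite !expf_eq0 (gt_eqF (rgt0 n)) !andbF.
apply: fine_cvg; rewrite mulrC EFinM EFin_cech_volume.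
rewrite -(integralZl measurableT (integrable_cech_link j)).
under [X in _ --> X]eq_integral do rewrite muleC.
have [|||||_ _] := @dominated_convergence _ _ _ (tuple_measure lebesgue_tuple j)
  setT measurableT
  (fun n t => (cech_link t)%:E * mean_local_product (r n) t)
  (fun t => (cech_link t)%:E * (density_moment j)%:E)
  (fun t => (M ^+ j)%:E * (cech_link t)%:E); last exact.
- by move=> n; exact: mrescaled.
- apply: emeasurable_funM; last exact: measurable_cst.
  by apply/measurable_EFinP; exact: measurable_cech_link.
- apply: aeW => t _; apply: cvgeZl => //; exact: mean_local_product_cvg.
- exact: (integrableZl measurableT _ (integrable_cech_link j)).
- apply: aeW => t n _; rewrite gee0_abs; last by rewrite mule_ge0// lee_fin.
  by rewrite muleC lee_wpmul2r// lee_fin.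
Qed.

End simplex_probability.

(** * Mean Euler characteristic of binomial and Poisson samples *)

Lemma Rintegral_cst_prob {R : realType} dsp (X : measurableType dsp)
    (mu : {measure set X -> \bar R}) (c : R) :
  mu setT = 1%E -> \int[mu]_x c = c.
Proof. by move=> mu1; rewrite Rintegral_cst// mu1 mulr1. Qed.

Section iid.
Context {R : realType} {d : nat}.
Variable F : probability (euclid R d) R.

Lemma iid_mean_euler_charE n (r : R) : 0 <= r ->
  iid_mean_euler_char F n r =
  \sum_(j < n) (-1) ^+ j * 'C(n, j.+1)%:R * simplex_prob F j r.
Proof.
move=> r0; rewrite /iid_mean_euler_char.
have mu1 := probability_setT F.
pose P (s : seq (euclid R d)) : R := (meeting_balls r s)%:R.
have P01 s : 0 <= P s <= 1 by rewrite /P; case: meeting_balls; rewrite !lexx !ler01.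
have mP k : measurable_fun setT (fun t : k.-tuple (euclid R d) => P t).
  exact: measurable_meeting_balls.
pose W (t : n.-tuple (euclid R d)) : R :=
  \sum_(m <- masks n) (-1) ^+ count id m * P (mask m t).
have -> : \int[tuple_measure F n]_x
    euler_char (cech_complex r [fset y in (x : seq (euclid R d))]%fset) =
    \int[tuple_measure F n]_x (1 - W x).
  apply: eq_Rintegral => t _; rewrite euler_char_cech size_tuple.
  by congr (1 - _); apply: eq_bigr.
have mW : measurable_fun setT W.
  rewrite (_ : W = fun t => \sum_(m <- masks n) (-1) ^+ count id m *
      (if size m == n then P (mask m t) else 0)); last first.
    apply/funext => t; rewrite /W big_seq [RHS]big_seq.
    by apply: eq_bigr => m /size_masks ->; rewrite eqxx.
  apply: measurable_sum => m; apply: measurable_funM => //.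
  by case: eqP => // mn; exact: measurable_mask.
have T1 : tuple_measure F n setT = 1%E by exact: tuple_measure_setT.
have iW : (tuple_measure F n).-integrable setT (EFin \o W).
  apply: (bounded_integrable_prob (M := \sum_(m <- masks n) 1)) => // t.
  apply: (le_trans (ler_norm_sum _ _ _)); apply: ler_sum => m _.
  rewrite normrM normrX normrN1 expr1n mul1r ger0_norm.
    by have /andP[] := P01 (mask m t).
  by have /andP[] := P01 (mask m t).
rewrite RintegralB//; last first.
  apply: (bounded_integrable_prob (M := 1)) => // t; by rewrite normr1.
pose q k : R := \int[tuple_measure F k]_t P (t : k.-tuple (euclid R d)).
have q0 : q 0%N = 1.
  rewrite -[RHS](Rintegral_cst_prob 1 (tuple_measure_setT 0 mu1)).
  by apply: eq_Rintegral => t _; rewrite (tuple0 t) /P meeting_balls0.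
have -> : \int[tuple_measure F n]_t W t =
    \sum_(k < n.+1) (-1) ^+ k * 'C(n, k)%:R * q k.
  exact: expected_signed_sum_masks.
rewrite (Rintegral_cst_prob _ T1) big_ord_recl/= bin0 !mul1r q0.
rewrite opprD addrA subrr add0r -sumrN; apply: eq_bigr => j _.
by rewrite /bump/= add1n exprS !mulN1r !mulNr opprK.
Qed.

End iid.

Section poisson_moments.
Local Open Scope ereal_scope.
Context {R : realType}.
Variables (rate : R) (k0 : nat).
Hypothesis rate0 : (0 < rate)%R.

Lemma poisson_pmfE k : poisson_pmf rate k = (rate ^+ k / k`!%:R * expR (- rate))%R.
Proof. by rewrite /poisson_pmf rate0. Qed.

Lemma ge0_integral_poisson (h : nat -> R) : (forall k, (0 <= h k)%R) ->
  \int[poisson_prob rate k0]_k (h k)%:E =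
  \sum_(k <oo) (poisson_pmf rate k * h k)%:E.
Proof.
move=> h0.
pose m_ k := mscale (NngNum (poisson_pmf_ge0 rate k)) (\d_k : {measure set nat -> \bar R}).
transitivity (\int[mseries m_ 0]_k (h k)%:E).
  apply: eq_measure_integral => A mA _ /=.
  rewrite /poisson_prob rate0 esum_mkcond -nneseries_esumT; last first.
    by move=> k; case: ifP => // _; rewrite lee_fin poisson_pmf_ge0.
  apply: eq_eseriesr => k _; rewrite /m_ /= /mscale /=.
  rewrite diracE.
  by case: (k \in A); rewrite ?mule1 ?mule0.
rewrite ge0_integral_measure_series//; last by move=> k _; rewrite lee_fin.
apply: eq_eseriesr => k _; rewrite ge0_integral_mscale//; last first.
  by move=> i _; rewrite lee_fin.
by rewrite integral_dirac//= diracT mul1e EFinM.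
Qed.

Lemma poisson_pmf_sum : \sum_(k <oo) (poisson_pmf rate k)%:E = 1.
Proof.
transitivity (\sum_(k <oo) (poisson_pmf rate k * 1)%:E).
  by apply: eq_eseriesr => k _; rewrite mulr1.
rewrite -(ge0_integral_poisson (fun=> ler01)) integral_cst// mul1e.
exact: probability_setT.
Qed.

(** Dividing the Poisson weights by factorials merely shifts them by [m]. *)
Lemma poisson_factorial_moment m :
  \int[poisson_prob rate k0]_k ('C(k, m)%:R)%:E = (rate ^+ m / m`!%:R)%:E.
Proof.
rewrite ge0_integral_poisson// (nneseries_split 0 m); last first.
  by move=> k _; rewrite lee_fin mulr_ge0// poisson_pmf_ge0.
rewrite add0n big_nat_cond big1 ?add0e; last first.
  by move=> k /andP[/andP[_ km] _]; rewrite bin_small// mulr0.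
rewrite -(nneseries_addn (f := fun k => (poisson_pmf rate k * 'C(k, m)%:R)%:E)); last first.
  by move=> k; rewrite lee_fin mulr_ge0// poisson_pmf_ge0.
rewrite -[RHS]mule1 -poisson_pmf_sum -nneseriesZl; last first.
  by move=> k _; rewrite lee_fin poisson_pmf_ge0.
apply: eq_eseriesr => k _; rewrite -EFinM !poisson_pmfE; congr (_%:E).
have := bin_fact (leq_addl k m); rewrite addnK => /(congr1 (fun x => x%:R : R)).
rewrite !natrM exprD => <-.
have c0 : 'C(k + m, m)%:R != 0%R :> R by rewrite pnatr_eq0 -lt0n bin_gt0 leq_addl.
have f0 i : i`!%:R != 0%R :> R by rewrite pnatr_eq0 -lt0n fact_gt0.
by field; rewrite c0 !f0.
Qed.

End poisson_moments.

Section poisson_exponential_moment.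
Local Open Scope ereal_scope.
Context {R : realType}.
Variables (rate : R) (k0 : nat).
Hypothesis rate0 : (0 < rate)%R.

Lemma poisson_exp2_lty : \int[poisson_prob rate k0]_k (2 ^+ k)%:E < +oo.
Proof.
rewrite ge0_integral_poisson//.
rewrite (eq_eseriesr (g := fun k => (expR rate)%:E * (poisson_pmf (2 * rate) k)%:E)).
  rewrite nneseriesZl; last by move=> k _; rewrite lee_fin poisson_pmf_ge0.
  by rewrite poisson_pmf_sum ?mulr_gt0// mule1 ltry.
move=> k _; rewrite -EFinM !poisson_pmfE ?mulr_gt0//; congr (_%:E).
rewrite mulrCA -expRD (_ : (rate + - (2 * rate) = - rate)%R); last by ring.
by rewrite exprMn; ring.
Qed.

(** Partial sums of an alternating binomial sum are dominated by [2 ^+ k],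
    whose Poisson mean is finite; hence the sum may be integrated termwise. *)
Lemma poisson_binomial_series (p : nat -> R) : (forall j, (0 <= p j <= 1)%R) ->
  (\sum_(j < J) (-1) ^+ j * (rate ^+ j.+1 / j.+1`!%:R) * p j)%R @[J --> \oo] -->
  (\int[poisson_prob rate k0]_k
     (\sum_(j < k) (-1) ^+ j * 'C(k, j.+1)%:R * p j))%R.
Proof.
move=> p01.
pose s J k : R := (\sum_(j < J) (-1) ^+ j * 'C(k, j.+1)%:R * p j)%R.
have s_bound J k : (`|s J k| <= 2 ^+ k)%R.
  apply: (le_trans (ler_norm_sum _ _ _)).
  apply: (@le_trans _ _ (\sum_(j < J) ('C(k, j.+1)%:R : R))%R).
    apply: ler_sum => j _; rewrite !normrM normrX normrN1 expr1n mul1r.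
    have /andP[pj0 pj1] := p01 j.
    by rewrite (ger0_norm pj0) ger0_norm// ler_piMr.
  rewrite -natr_sum -natrX ler_nat.
  apply: (@leq_trans (\sum_(j < J.+1) 'C(k, j))); first by rewrite [leqRHS]big_ord_recl leq_addl.
  elim: J => [|J IH]; first by rewrite big_ord_recl big_ord0 bin0 addn0 expn_gt0.
  have [kJ|Jk] := ltnP k J.+1.
    by rewrite big_ord_recr/= bin_small// addn0.
  rewrite -[X in (2 ^ X)%N](subnK Jk).
  have : (\sum_(j < k.+1) 'C(k, j) = 2 ^ k)%N.
    rewrite -[2%N]/(1 + 1)%N expnDn; apply: eq_bigr => j _.
    by rewrite !exp1n !muln1.
  rewrite subnK// => <-.
  rewrite -!(big_mkord xpredT (fun j => 'C(k, j))).
  by rewrite [leqRHS](@big_cat_nat _ _ _ J.+2)//= leq_addr.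
have mfun (h : nat -> R) : measurable_fun setT h by [].
have ip2 : (poisson_prob rate k0).-integrable setT (EFin \o (fun k : nat => 2 ^+ k : R)%R).
  apply/integrableP; split; first exact/measurable_EFinP.
  under eq_integral do rewrite /= ger0_norm ?exprn_ge0//.
  exact: poisson_exp2_lty.
have is_ J : (poisson_prob rate k0).-integrable setT (EFin \o s J).
  apply: (le_integrable measurableT _ _ ip2) => [//|k _ /=]; rewrite lee_fin [leRHS]ger0_norm ?exprn_ge0//.
have iC m : (poisson_prob rate k0).-integrable setT
    (EFin \o (fun k : nat => 'C(k, m)%:R : R)%R).
  apply/integrableP; split; first exact/measurable_EFinP.
  under eq_integral do rewrite /= ger0_norm//.
  by rewrite poisson_factorial_moment// ltry.
have sE J : (\sum_(j < J) (-1) ^+ j * (rate ^+ j.+1 / j.+1`!%:R) * p j)%R =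
    (\int[poisson_prob rate k0]_k s J k)%R.
  rewrite /s; under [RHS]eq_Rintegral do under eq_bigr do rewrite mulrAC.
  rewrite (Rintegral_lincomb _ (fun j : 'I_J => (-1) ^+ j * p j)%R
    (h := fun (j : 'I_J) k => 'C(k, j.+1)%:R)) //.
  apply: eq_bigr => j _; rewrite /Rintegral poisson_factorial_moment//=.
  by rewrite mulrAC.
under eq_fun do rewrite sE.
apply: fine_cvg.
have iS : (poisson_prob rate k0).-integrable setT
    (EFin \o (fun k => s k k)).
  by apply: (le_integrable measurableT _ _ ip2) => [//|k _ /=]; rewrite lee_fin [leRHS]ger0_norm ?exprn_ge0.
rewrite fineK; last exact: (integrable_fin_num measurableT iS).
have [|||||_ _] := @dominated_convergence _ _ _ (poisson_prob rate k0)
  setT measurableT (fun J k => (s J k)%:E) (fun k => (s k k)%:E)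
  (fun k => (2 ^+ k)%:E); last exact.
- by move=> J; exact/measurable_EFinP.
- exact/measurable_EFinP.
- apply: aeW => k _; apply: cvg_near_cst.
  exists k => // J /= kJ; congr (_%:E); rewrite /s.
  rewrite -!(big_mkord xpredT (fun j => (-1) ^+ j * 'C(k, j.+1)%:R * p j)%R).
  rewrite (@big_cat_nat _ _ _ k)//= [X in (_ + X)%R]big_nat_cond.
  rewrite [X in (_ + X)%R]big1 ?addr0// => j /andP[/andP[kj _] _].
  by rewrite bin_small// mulr0 mul0r.
- exact: ip2.
- by apply: aeW => k J _; rewrite lee_fin.
Qed.

End poisson_exponential_moment.

(** * The thermodynamic limit *)

Section tannery.
Context {R : realType}.

(** Tannery's theorem, i.e. dominated convergence for series: beyond some rank the
    tails of all the series are bounded by that of [b]. *)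
Lemma tannery (u : nat -> nat -> R) (U l b : nat -> R) :
  (\forall n \near \oo, series (u n) @ \oo --> U n) ->
  (forall j, u n j @[n --> \oo] --> l j) ->
  (\forall n \near \oo, forall j, `|u n j| <= b j) ->
  cvgn (series b) ->
  cvgn (series l) /\ U n @[n --> \oo] --> limn (series l).
Proof.
move=> uU ul ub cb.
have lb j : `|l j| <= b j.
  apply: (closed_cvg (fun x => x <= b j) (@closed_le _ (b j)) _ _ (cvg_norm (ul j))).
  by apply: filterS ub => n; exact.
have b0 j : 0 <= b j by exact: le_trans (lb j).
have cl : cvgn (series l).
  apply: normed_cvg; apply: (series_le_cvg (v_ := b)) => // n.
  exact: normr_ge0.
split => //; apply/cvgrPdist_le => e e0.
have e40 : 0 < e / 4 by rewrite divr_gt0.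
have ndb : nondecreasing_seq (series b) by exact: nondecreasing_series.
have [J _ HJ] : \forall J \near \oo, `|limn (series b) - series b J| <= e / 4.
  by move/cvgrPdist_le : cb => /(_ _ e40).
have tail N : (J <= N)%N -> \sum_(J <= j < N) b j <= e / 4.
  move=> JN; have -> : \sum_(J <= j < N) b j = series b N - series b J.
    by rewrite sub_series_geq.
  rewrite (le_trans _ (HJ J (leqnn J)))// (le_trans _ (ler_norm _))// lerD2r.
  exact: nondecreasing_cvgn_le.
have H1 : \forall n \near \oo, \sum_(0 <= j < J) `|u n j - l j| <= e / 4.
  have : (\sum_(0 <= j < J) `|u n j - l j|) @[n --> \oo] --> \sum_(0 <= j < J) (0 : R).
    apply: cvg_big => [|j _]; first exact: add_continuous.
    rewrite -(normr0 R) -(subrr (l j)); apply: cvg_norm; apply: cvgB => //.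
    exact: cvg_cst.
  rewrite big1//.
  move=> /cvgrPdist_le /(_ _ e40); apply: filterS => n.
  by rewrite sub0r normrN ger0_norm// sumr_ge0.
near=> n; rewrite distrC.
have Un : series (u n) @ \oo --> U n by near: n.
apply: (closed_cvg (fun x => x <= e) (@closed_le _ e) _ _
  (cvg_norm (cvgB Un cl))).
exists J => // N /= JN.
rewrite -[leLHS]/(`|series (u n) N - series l N|) /series/= -sumrB.
apply: (le_trans (ler_norm_sum _ _ _)).
rewrite (@big_cat_nat _ _ _ J)//=.
apply: (@le_trans _ _ (e / 4 + (e / 4 + e / 4))); last by lra.
apply: lerD; first by near: n.
have bn j : `|u n j| <= b j by move: j; near: n.
apply: (@le_trans _ _ (\sum_(J <= j < N) b j + \sum_(J <= j < N) b j)).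
  rewrite -big_split/=; apply: ler_sum => j _.
  by rewrite (le_trans (ler_normB _ _))// lerD.
by apply: lerD; exact: tail.
Unshelve. all: by end_near. Qed.

End tannery.

Section sampling_coefficients.
Context {R : realType}.

(** The mean number of [j]-simplices, divided by [simplex_prob]. *)
Definition sampling_coef (S : sampling) (n j : nat) : R :=
  match S with
  | BernoulliSampling => 'C(n, j.+1)%:R
  | PoissonSampling => n%:R ^+ j.+1 / j.+1`!%:R
  end.

Lemma sampling_coef_ge0 S n j : 0 <= sampling_coef S n j.
Proof. by case: S => //=; rewrite divr_ge0// exprn_ge0. Qed.

(** The common bound and the common equivalent of the coefficients are the reason
    why both ways of sampling have the same limit. *)
Lemma sampling_coef_le S n j : sampling_coef S n j <= n%:R ^+ j.+1 / j.+1`!%:R.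
Proof.
case: S => //=; rewrite ler_pdivlMr ?ltr0n ?fact_gt0// -natrM bin_ffact.
rewrite -natrX ler_nat ffact_prod -[j.+1 in leqRHS]card_ord -prod_nat_const.
by apply: leq_prod => i _; exact: leq_subr.
Qed.

Lemma sampling_coef_cvg S j :
  sampling_coef S n j / n%:R ^+ j.+1 @[n --> \oo] --> (j.+1`!%:R^-1 : R).
Proof.
have f0 : (j.+1)`!%:R != 0 :> R by rewrite pnatr_eq0 -lt0n fact_gt0.
case: S => /=; last first.
  apply: cvg_near_cst; exists 1%N => // n /= n1; rewrite mulrAC divff ?mul1r//.
  by rewrite expf_eq0/= pnatr_eq0 -lt0n.
rewrite [X in X @ _ --> _](_ : _ = (fun n =>
    (\prod_(i < j.+1) ((n - i)%:R / n%:R)) / (j.+1)`!%:R)); last first.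
  apply/funext => n; rewrite big_split/= prodr_const card_ord -exprVn.
  rewrite mulrAC; congr (_ * _).
  by rewrite -natr_prod -ffact_prod -bin_ffact natrM mulfK.
rewrite -[X in _ --> X]mul1r; apply: cvgM; last exact: cvg_cst.
rewrite [X in _ --> X](_ : _ = \prod_(i < j.+1) 1); last by rewrite big1.
apply: cvg_big => [|i _]; first exact: mul_continuous.
have : (1 - i%:R * (n%:R)^-1 : R) @[n --> \oo] --> (1 - i%:R * 0 : R).
  apply: cvgB; first exact: cvg_cst.
  apply: cvgM; first exact: cvg_cst.
  apply/gtr0_cvgV0; last exact: cvgr_idn.
  by exists 1%N => // n /= n1; rewrite ltr0n.
rewrite mulr0 subr0; apply: cvg_trans; apply: near_eq_cvg.
exists i.+1 => // n /= ni; rewrite natrB ?(ltnW ni)// mulrBl divff//.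
by rewrite pnatr_eq0 -lt0n (leq_trans _ ni).
Qed.

End sampling_coefficients.

Section mean_euler_char_expansion.
Context {R : realType} {d : nat}.
Variables (S : sampling) (F : probability (euclid R d) R).

Lemma simplex_prob_le1 j (r : R) : 0 <= r -> simplex_prob F j r <= 1.
Proof.
move=> r0; have F1 : tuple_measure F j.+1 setT = 1%E.
  exact: tuple_measure_setT (probability_setT F).
rewrite -[leRHS](Rintegral_cst_prob 1 F1).
have mb := @measurable_meeting_balls R d r j.+1 r0.
apply: le_Rintegral => //.
- apply: (bounded_integrable_prob (M := 1)) => // t.
  by case: meeting_balls; rewrite ?normr1 ?normr0.
- by apply: (bounded_integrable_prob (M := 1)) => // t; rewrite normr1.
- by move=> t _; case: meeting_balls.
Qed.

Lemma mean_euler_char_series n (r : R) : (0 < n)%N -> 0 <= r ->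
  series (fun j => (-1) ^+ j * sampling_coef S n j * simplex_prob F j r) @ \oo -->
  mean_euler_char S F n r.
Proof.
move=> n0 r0; rewrite /series/= /mean_euler_char; case: S => /=.
  apply: cvg_near_cst; exists n => // J /= nJ.
  rewrite iid_mean_euler_charE// (@big_cat_nat _ _ _ n)//= big_mkord.
  rewrite [X in _ + X]big_nat_cond [X in _ + X]big1 ?addr0// => j /andP[/andP[nj _] _].
  by rewrite bin_small// mulr0 mul0r.
under eq_Rintegral do rewrite iid_mean_euler_charE//.
have n0' : (0 : R) < n%:R by rewrite ltr0n.
have p01 j : 0 <= simplex_prob F j r <= 1.
  by rewrite simplex_prob_ge0 simplex_prob_le1.
have := @poisson_binomial_series R n%:R 0 n0' _ p01.
by under eq_fun do rewrite -(big_mkord xpredT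
  (fun j => (-1) ^+ j * (n%:R ^+ j.+1 / (j.+1)`!%:R) * simplex_prob F j r)).
Qed.

End mean_euler_char_expansion.

Section eecc_series.
Context {R : realType} {d : nat}.
Variables (S : sampling) (F : probability (euclid R d) R) (f : euclid R d -> R).
Hypothesis Ff : bounded_density F f.
Hypothesis d_gt0 : (0 < d)%N.

Local Notation w := (@unit_ball_volume R d).

Definition eecc_coef (j : nat) : R :=
  (-1) ^+ j * cech_volume d j / ((j.+1)`!%:R * w ^+ j).

Lemma eecc_coef_neq0 j : eecc_coef j != 0.
Proof.
rewrite /eecc_coef mulf_neq0//.
  by rewrite mulf_neq0 ?signr_eq0// gt_eqF// cech_volume_gt0.
rewrite invr_eq0 mulf_neq0 ?pnatr_eq0 -?lt0n ?fact_gt0//.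
by rewrite expf_neq0// gt_eqF// unit_ball_volume_gt0.
Qed.

Lemma thermodynamic_cvg0 (L : R) (r : nat -> R) :
  thermodynamic (d := d) L r -> r @ \oo --> 0.
Proof.
move=> [r0 rL]; have w0 := unit_ball_volume_gt0 (R := R) d_gt0.
have rd0 : r n ^+ d @[n --> \oo] --> 0.
  have : (n%:R * w * r n ^+ d) * (w^-1 * (n%:R)^-1) @[n --> \oo] --> L * (w^-1 * 0).
    apply: cvgM => //; apply: cvgM; first exact: cvg_cst.
    apply/gtr0_cvgV0; last exact: cvgr_idn.
    by exists 1%N => // n /= n1; rewrite ltr0n.
  rewrite !mulr0; apply: cvg_trans; apply: near_eq_cvg.
  have wn0 : w != 0 by rewrite gt_eqF.
  exists 1%N => // n /= n1; have n0 : n%:R != 0 :> R by rewrite pnatr_eq0 -lt0n.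
  by field; rewrite ?n0 ?wn0.
apply/cvgrPdist_le => e e0.
have ed0 : 0 < e ^+ d by exact: exprn_gt0.
move/cvgrPdist_le : rd0 => /(_ _ ed0); apply: filterS => n.
rewrite !sub0r !normrN normrX ger0_norm ?(ltW (r0 n))//.
by rewrite ler_pXn2r ?nnegrE ?(ltW e0) ?(ltW (r0 n)).
Qed.

Let mean_euler_char_limit (L : R) (r : nat -> R) (M : R) : (forall x, f x <= M) ->
  0 < L -> thermodynamic (d := d) L r ->
  cvgn (series (fun j => eecc_coef j * density_moment F f j * L ^+ j)) /\
  n%:R^-1 * mean_euler_char S F n (r n) @[n --> \oo] -->
  limn (series (fun j => eecc_coef j * density_moment F f j * L ^+ j)).
Proof.
move=> fM L0 thr; have [r0 rL] := thr; have rcvg0 := thermodynamic_cvg0 thr.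
have w0 := unit_ball_volume_gt0 (R := R) d_gt0.
have M0 : 0 <= M by have [_ f0 _ _] := Ff; exact: le_trans (f0 point) (fM point).
have nrL : n%:R * r n ^+ d @[n --> \oo] --> L / w.
  have : (n%:R * w * r n ^+ d) / w @[n --> \oo] --> L / w.
    by apply: cvgM => //; exact: cvg_cst.
  apply: cvg_trans; apply: near_eq_cvg; apply: nearW => n.
  by field; rewrite gt_eqF.
have wn0 : w != 0 by rewrite gt_eqF.
have f0 j : (j.+1)`!%:R != 0 :> R by rewrite pnatr_eq0 -lt0n fact_gt0.
pose A := M * 4 ^+ d.
have A0 : 0 <= A by rewrite mulr_ge0// exprn_ge0.
(* Eventually [n * r n ^+ d <= L / w + 1], so the terms are dominated by those of
   the exponential series of [B]. *)
pose B := (L / w + 1) * A.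
have B0 : 0 <= B by rewrite mulr_ge0// addr_ge0// divr_ge0// ltW.
apply: (@tannery _ (fun n j => n%:R^-1 *
   ((-1) ^+ j * sampling_coef S n j * simplex_prob F j (r n))) _ _ (exp_coeff B)).
- exists 1%N => // n /= n1.
  have H := @mean_euler_char_series R d S F n (r n) n1 (ltW (r0 n)).
  have : (n%:R^-1 : R) * series (fun j => (-1) ^+ j * sampling_coef S n j *
      simplex_prob F j (r n)) J @[J --> \oo] --> n%:R^-1 * mean_euler_char S F n (r n).
    by apply: cvgM => //; exact: cvg_cst.
  apply: cvg_trans; apply: near_eq_cvg; apply: nearW => J.
  by rewrite /series/= mulr_sumr.
- move=> j.
  have nrLj : (n%:R * r n ^+ d) ^+ j @[n --> \oo] --> (L / w) ^+ j.
    exact: (cvg_comp _ _ nrL (@exprn_continuous R j (L / w))).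
  have : ((-1) ^+ j * (sampling_coef S n j / n%:R ^+ j.+1)) *
      ((n%:R * r n ^+ d) ^+ j * (simplex_prob F j (r n) / (r n ^+ d) ^+ j))
      @[n --> \oo] --> ((-1) ^+ j * ((j.+1)`!%:R)^-1) *
      ((L / w) ^+ j * (cech_volume d j * density_moment F f j)).
    apply: cvgM; apply: cvgM => //.
    - exact: cvg_cst.
    - exact: sampling_coef_cvg.
    - exact: (simplex_prob_cvg Ff fM).
  rewrite [X in _ --> X -> _](_ : _ = eecc_coef j * density_moment F f j * L ^+ j); last first.
    rewrite /eecc_coef exprMn exprVn.
    by field; rewrite ?f0 ?expf_neq0.
  apply: cvg_trans; apply: near_eq_cvg; exists 1%N => // n /= n1.
  rewrite /= exprMn exprS.
  have n0 : n%:R != 0 :> R by rewrite pnatr_eq0 -lt0n.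
  have rd0 : (r n ^+ d) ^+ j != 0 by rewrite !expf_neq0// gt_eqF.
  by field; rewrite ?rd0 ?n0 ?expf_neq0 ?f0.
- have : \forall n \near \oo, n%:R * r n ^+ d <= L / w + 1.
    move/cvgrPdist_le : nrL => /(_ _ ltr01); apply: filterS => n.
    by rewrite distrC ler_distl => /andP[].
  move=> [N1 _ HN1]; exists N1.+1 => // n /= Nn j.
  have n0 : (0 : R) < n%:R by rewrite ltr0n (leq_ltn_trans _ Nn).
  have nr := HN1 n (ltnW Nn).
  have rd0 : 0 <= r n ^+ d by rewrite exprn_ge0// ltW.
  rewrite !normrM normrX normrN1 expr1n mul1r.
  rewrite (ger0_norm (sampling_coef_ge0 _ _ _)) (ger0_norm (simplex_prob_ge0 _ _ _)).
  rewrite gtr0_norm ?invr_gt0//.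
  apply: (@le_trans _ _ (n%:R^-1 * (n%:R ^+ j.+1 / (j.+1)`!%:R * (r n ^+ d * A) ^+ j))).
    rewrite ler_wpM2l ?invr_ge0 ?(ltW n0)// ler_pM ?sampling_coef_ge0 ?simplex_prob_ge0//.
      exact: sampling_coef_le.
    exact: (simplex_prob_le Ff fM).
  rewrite [leLHS](_ : _ = (n%:R * r n ^+ d * A) ^+ j / (j.+1)`!%:R); last first.
    by rewrite exprS !exprMn; field; rewrite ?f0 ?(gt_eqF n0).
  rewrite /exp_coeff /= ler_pM ?invr_ge0//.
  + by rewrite exprn_ge0// mulr_ge0// mulr_ge0// ltW.
  + rewrite lerXn2r ?nnegrE//; first by rewrite mulr_ge0// mulr_ge0// ltW.
    by rewrite ler_wpM2r.
  + by rewrite lef_pV2 ?posrE ?ltr0n ?fact_gt0// ler_nat factS leq_pmull.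
- exact: is_cvg_series_exp_coeff.
Qed.

Let thermodynamic_exists (L : R) : 0 < L ->
  exists r : nat -> R, thermodynamic (d := d) L r.
Proof.
move=> L0; have w0 := unit_ball_volume_gt0 (R := R) d_gt0.
(* The solution of [n * w * r ^+ d = L] for [n > 0], and any positive value for
   [n = 0]. *)
pose a n : R := L / ((if n == 0%N then 1 else n%:R) * w).
have a0 n : 0 < a n.
  rewrite divr_gt0// mulr_gt0//; case: eqP => // /eqP n0.
  by rewrite ltr0n lt0n.
exists (fun n => a n `^ d%:R^-1); split => [n|]; first exact: powR_gt0.
apply: cvg_near_cst; exists 1%N => // n /= n1.
rewrite -powR_mulrn ?powR_ge0// -powRrM mulVf ?pnatr_eq0 -?lt0n//.
rewrite powRr1 ?(ltW (a0 n))// /a gtn_eqF//.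
have wn0 : w != 0 by rewrite gt_eqF.
have nn0 : n%:R != 0 :> R by rewrite pnatr_eq0 -lt0n.
by field; rewrite ?wn0 ?nn0.
Qed.

(** In the limit the mean number of [j]-simplices per point is proportional to
    [(n * r n ^+ d) ^+ j], hence to [L ^+ j].  The curve is defined as a limit
    over all sequences of radii, so one such sequence has to exist for the
    definition to determine its value. *)
Lemma eecc_series (L : R) : 0 < L ->
  cvgn (series (fun j => eecc_coef j * density_moment F f j * L ^+ j)) /\
  eecc S F L = limn (series (fun j => eecc_coef j * density_moment F f j * L ^+ j)).
Proof.
move=> L0; have [_ _ [M fM] _] := Ff.
have [r thr] := thermodynamic_exists L0.
have [cs lim_r] := mean_euler_char_limit fM L0 thr; split => //.
rewrite /eecc gt_eqF//.
set P := [set l : R | _].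
have PL : P (limn (series (fun j => eecc_coef j * density_moment F f j * L ^+ j))).
  by move=> r' thr'; have [] := mean_euler_char_limit fM L0 thr'.
have /(_ r thr) := @getPex _ P (ex_intro _ _ PL).
by move/cvg_unique; exact.
Qed.

End eecc_series.
Arguments eecc_coef {R} d j.

(** * Recovering the excess mass *)

Section power_series.
Context {R : realType}.

(** If [N] is the least index with [c N != 0], dividing the series by [L ^+ N] and
    letting [L] tend to [0] through [1 / n.+1] leaves [c N].  Convergence at [L = 2]
    provides a geometric bound that is uniform for [L <= 1]. *)
Lemma power_series_eq0 (c : nat -> R) :
  (forall L, 0 < L -> series (fun j => c j * L ^+ j) @ \oo --> (0 : R)) ->
  forall j, c j = 0.
Proof.
move=> c0; apply: ltn_ind => N IH.
have [K cK] : exists K, forall j, `|c j| <= K * 2^-1 ^+ j.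
  have cv := c0 2 (ltr0Sn _ 1).
  have [K [_ HK]] : bounded_fun (fun j => c j * 2 ^+ j).
    by apply: cvg_series_bounded; apply/cvg_ex; exists 0.
  exists (K + 1) => j; have := HK (K + 1) ltac:(by rewrite ltrDl) j I.
  rewrite /= normrM normrX (ger0_norm (ler0n R 2)) => Hj.
  by rewrite exprVn ler_pdivlMr ?exprn_gt0.
pose b j := K * 2^-1 ^+ (N + j).
pose l j := if j == 0%N then c N else 0.
have [||||_ + ] := @tannery R (fun n j => c (N + j)%N * n.+1%:R^-1 ^+ j) (fun=> 0) l b.
- apply: nearW => n; have L0 : (0 : R) < n.+1%:R^-1 by rewrite invr_gt0.
  have : (n.+1%:R ^+ N : R) * series (fun j => c j * n.+1%:R^-1 ^+ j) (J + N)%N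
      @[J --> \oo] --> (n.+1%:R ^+ N : R) * 0.
    apply: cvgM; first exact: cvg_cst.
    by rewrite (cvg_shiftn N (series _)); exact: c0.
  rewrite mulr0; apply: cvg_trans; apply: near_eq_cvg; apply: nearW => J.
  rewrite /series/= mulr_sumr (@big_cat_nat _ _ _ N)//= ?leq_addl//.
  rewrite big_nat_cond big1 ?add0r; last first.
    by move=> i /andP[/andP[_ iN] _]; rewrite IH// mul0r mulr0.
  rewrite -{1}(add0n N) big_addn addnK; apply: eq_bigr => j _.
  have qN : (n.+1%:R : R) ^+ N * n.+1%:R^-1 ^+ N = 1.
    by rewrite -exprMn divff ?expr1n// pnatr_eq0.
  by rewrite addnC exprD mulrCA [X in c _ * X = _]mulrA qN mul1r.
- move=> j; rewrite /l; case: j => [|j] /=.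
    under eq_fun do rewrite expr0 mulr1 addn0; exact: cvg_cst.
  have : c (N + j.+1)%N * (n.+1%:R^-1 ^+ j.+1) @[n --> \oo] --> c (N + j.+1)%N * (0 : R) ^+ j.+1.
    apply: cvgM; first exact: cvg_cst.
    apply: (cvg_comp _ _ (@cvg_harmonic R) (@exprn_continuous R j.+1 0)).
  by rewrite expr0n mulr0.
- apply: nearW => n j; rewrite normrM (le_trans _ (cK (N + j)%N))//.
  rewrite ler_piMr// ger0_norm ?exprn_ge0 ?invr_ge0//.
  by rewrite exprn_ile1 ?invr_ge0// invf_le1 ?ler1n.
- rewrite (_ : b = geometric (K * 2^-1 ^+ N) 2^-1); last first.
    by apply/funext => j; rewrite /b /geometric/= exprD mulrA.
  by apply: is_cvg_geometric_series; rewrite ger0_norm// invf_lt1// ltr1n.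
have : series l @ \oo --> c N.
  apply: cvg_near_cst; exists 1%N => // J /= J1.
  rewrite /series/= big_ltn// big_nat_cond big1 ?addr0// => j /andP[/andP[j0 _] _].
  by rewrite /l gtn_eqF.
move=> /cvg_lim -> // H; apply/esym.
by have /cvg_lim <- // := H; rewrite lim_cst.
Qed.

End power_series.

Section threshold_polynomials.
Context {R : realType}.

Lemma bernoulli_ineq (y : R) n : -1 <= y -> 1 + n%:R * y <= (1 + y) ^+ n.
Proof.
move=> y1; elim: n => [|n IH]; first by rewrite mul0r addr0 expr0.
have y10 : 0 <= 1 + y by rewrite -lerBlDl sub0r.
rewrite exprS; apply: le_trans (ler_wpM2l y10 IH).
rewrite -natr1; have : 0 <= n%:R * y ^+ 2 by rewrite mulr_ge0// sqr_ge0.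
by rewrite expr2; lra.
Qed.

(** With [p = Num.sqrt q], Bernoulli's inequality bounds [n * p ^+ n], and the
    second factor [p ^+ n] of [q ^+ n] tends to [0]. *)
Lemma exprn_mulrn_cvg0 (q : R) : 0 <= q -> q < 1 ->
  n%:R * q ^+ n @[n --> \oo] --> (0 : R).
Proof.
move=> q0 q1; have [->|qn0] := eqVneq q 0.
  by apply: cvg_near_cst; exists 1%N => // n /= n1; rewrite expr0n gtn_eqF// mulr0.
pose p := Num.sqrt q.
have p0 : 0 < p by rewrite sqrtr_gt0 lt0r qn0.
have p1 : p < 1 by rewrite -sqrtr1 ltr_sqrt.
have d0 : 0 < p^-1 - 1 by rewrite subr_gt0 invf_gt1.
apply: (@squeeze_cvgr _ _ _ _ (cst 0) (fun n => (p^-1 - 1)^-1 * p ^+ n)).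
- apply: nearW => n; apply/andP; split; first by rewrite mulr_ge0// exprn_ge0.
  rewrite -[q]sqr_sqrtr// -/p -exprM mulnC exprM expr2 mulrA.
  rewrite ler_wpM2r ?exprn_ge0 ?(ltW p0)//.
  rewrite -ler_pdivlMr ?exprn_gt0// -exprVn mulrC -ler_pdivrMr ?invr_gt0// invrK.
  have pE : 1 + (p^-1 - 1) = p^-1 by rewrite addrC subrK.
  rewrite -[in leRHS]pE; apply: le_trans (bernoulli_ineq _ _); last by lra.
  by rewrite lerDr.
- exact: cvg_cst.
- rewrite -(mulr0 (p^-1 - 1)^-1); apply: cvgM; first exact: cvg_cst.
  by apply: cvg_expr; rewrite ger0_norm// ltW.
Qed.

(** For [c = 1 / (k * t)], Bernoulli's inequality compares the value at [s] with
    [n * (s / t) ^+ n], which tends to [0] below [t] and to infinity from [t] on.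
    The extra factor [n] in the exponent is for [s = t]: there the powers of
    [s / t] stay equal to [1], and the excess mass counts the points with [f x = t]
    as exceeding. *)
Definition threshold_poly (c : R) (k n : nat) : {poly R} :=
  (1 - (c *: 'X) ^+ n) ^+ (n * k ^ n).

Lemma threshold_polyE (c : R) k n s :
  (threshold_poly c k n).[s] = (1 - (c * s) ^+ n) ^+ (n * k ^ n).
Proof. by rewrite /threshold_poly !hornerE. Qed.

Lemma threshold_poly01 (c : R) k n s : 0 <= c * s <= 1 ->
  0 <= (threshold_poly c k n).[s] <= 1.
Proof.
move=> /andP[s0 s1]; rewrite threshold_polyE.
have h0 : 0 <= 1 - (c * s) ^+ n by rewrite subr_ge0 exprn_ile1.
by rewrite exprn_ge0//= exprn_ile1// gerBl exprn_ge0.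
Qed.

Lemma threshold_poly_cvg (t : R) (k : nat) s : 0 < t -> (0 < k)%N ->
  0 <= s <= k%:R * t ->
  (threshold_poly (k%:R * t)^-1 k n).[s] @[n --> \oo] --> ((s < t)%R%:R : R).
Proof.
move=> t0 k0 /andP[s0 sk]; pose c := (k%:R * t)^-1.
have kR0 : (0 : R) < k%:R by rewrite ltr0n.
have c0 : 0 < c by rewrite invr_gt0 mulr_gt0.
have cs : 0 <= c * s <= 1.
  by rewrite mulr_ge0 ?(ltW c0)//= /c mulrC ler_pdivrMr ?mulr_gt0// mul1r.
have /andP[cs0 cs1] := cs.
have x0 n : 0 <= (c * s) ^+ n by exact: exprn_ge0.
have x1 n : (c * s) ^+ n <= 1 by exact: exprn_ile1.
have Nx n : (n * k ^ n)%:R * (c * s) ^+ n = n%:R * (s / t) ^+ n.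
  rewrite natrM -mulrA natrX -exprMn; congr (_ * _ ^+ n).
  by rewrite /c; field; rewrite ?gt_eqF.
have [st|ts] := ltP s t.
  apply: (@squeeze_cvgr _ _ _ _ (fun n => 1 - n%:R * (s / t) ^+ n) (cst 1)).
  - apply: nearW => n; have /andP[_ ->] := threshold_poly01 k n cs; rewrite andbT.
    rewrite threshold_polyE -Nx -mulrN; apply: bernoulli_ineq.
    by rewrite lerN2.
  - rewrite -[X in _ --> X](subr0 (1 : R)); apply: cvgB; first exact: cvg_cst.
    apply: exprn_mulrn_cvg0; first by rewrite divr_ge0// ltW.
    by rewrite ltr_pdivrMr// mul1r.
  - exact: cvg_cst.
(* From [(1 - x) * (1 + x) <= 1] and [1 + N * x <= (1 + x) ^+ N] the value at [s]
   is at most [1 / (1 + N * x)]. *)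
apply: (@squeeze_cvgr _ _ _ _ (cst 0) (fun n => n.+1%:R^-1)).
- apply: nearW => n; have /andP[-> _] := threshold_poly01 k n cs.
  rewrite /= threshold_polyE.
  set x := (c * s) ^+ n; set N := (n * k ^ n)%N.
  have nNx : n.+1%:R <= 1 + N%:R * x.
    rewrite Nx -natr1 addrC lerD2l ler_peMr// exprn_ege1//.
    by rewrite ler_pdivlMr// mul1r.
  have x10 : 0 <= 1 - x by rewrite subr_ge0 x1.
  have N0 : 0 <= (1 - x) ^+ N by rewrite exprn_ge0.
  rewrite -[leRHS]mul1r ler_pdivlMr//.
  apply: (le_trans (ler_wpM2l N0 nNx)).
  apply: (@le_trans _ _ ((1 - x) ^+ N * (1 + x) ^+ N)).
    apply: ler_wpM2l => //; apply: bernoulli_ineq.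
    by rewrite (le_trans _ (x0 n))// lerN10.
  rewrite -exprMn exprn_ile1//.
    by rewrite mulr_ge0// addr_ge0// x0.
  rewrite (_ : _ * _ = 1 - x ^+ 2); last by ring.
  by rewrite gerBl sqr_ge0.
- exact: cvg_cst.
- exact: cvg_harmonic.
Qed.

End threshold_polynomials.

Section excess_mass.
Context {R : realType} {d : nat}.
Variables (F : probability (euclid R d) R) (f : euclid R d -> R).
Hypothesis Ff : bounded_density F f.

Let measurable_above t : measurable_fun setT (fun x => \1_(`[t, +oo[) (f x) : R).
Proof.
have [mf _ _ _] := Ff.
have mt : measurable_fun [set: R] (\1_(`[t, +oo[%classic) : R -> R).
  by apply: measurable_indic; exact: measurable_itv.
exact: (measurableT_comp mt mf).
Qed.

Lemma excess_massE t : excess_mass f t = \int[F]_x (\1_(`[t, +oo[) (f x) : R).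
Proof.
have [mf f0 _ FE] := Ff.
rewrite /excess_mass /Rintegral; congr fine.
rewrite (ge0_integral_density (mu := lebesgue_tuple) mf f0 FE)//.
- by apply: eq_integral => x _; rewrite mulrC EFinM.
- exact/measurable_EFinP.
Qed.

Lemma excess_mass0 : excess_mass f 0 = 1.
Proof.
have [mf f0 _ FE] := Ff; rewrite excess_massE.
rewrite -[RHS](Rintegral_cst_prob 1 (probability_setT F)).
by apply: eq_Rintegral => x _; rewrite indicE mem_set//= in_itv/= f0.
Qed.

Lemma integral_poly (p : {poly R}) :
  \int[F]_x p.[f x] = \sum_(i < size p) p`_i * density_moment F f i.
Proof.
have [mf f0 [M fM] _] := Ff.
under eq_Rintegral do rewrite horner_coef.
rewrite (Rintegral_lincomb _ (fun i : 'I_(size p) => p`_i) (h := fun i x => f x ^+ i))//.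
move=> i; apply: (bounded_integrable_prob (M := M ^+ i)).
- exact: probability_setT.
- exact: measurable_funX.
- move=> x; rewrite ger0_norm ?exprn_ge0// lerXn2r ?nnegrE//.
  exact: le_trans (f0 x) (fM x).
Qed.

(** A number [k] with [f <= k * t] places the values of [f] where the threshold
    polynomials are bounded by [1]. *)
Lemma excess_mass_limit (t : R) (k : nat) : 0 < t -> (0 < k)%N ->
  (forall x, f x <= k%:R * t) ->
  \int[F]_x (threshold_poly (k%:R * t)^-1 k n).[f x] @[n --> \oo] -->
  1 - excess_mass f t.
Proof.
move=> t0 k0 fk; have [mf f0 _ _] := Ff.
have kt0 : 0 < k%:R * t by rewrite mulr_gt0// ltr0n.
have F1 := probability_setT F.
have m1 := measurable_above t.
have -> : 1 - excess_mass f t = \int[F]_x ((f x < t)%R%:R : R).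
  rewrite excess_massE -[X in X - _](Rintegral_cst_prob 1 F1) -RintegralB//.
  - apply: eq_Rintegral => x _; rewrite indicE.
    have [ft|tf] := ltP (f x) t.
      by rewrite memNset ?subr0//= in_itv/= andbT; apply/negP; rewrite -ltNge.
    by rewrite mem_set ?subrr//= in_itv/= andbT.
  - by apply: (bounded_integrable_prob (M := 1)) => // x; rewrite normr1.
  - apply: (bounded_integrable_prob (M := 1)) => // x.
    by rewrite indicE; case: (_ \in _); rewrite ?normr1 ?normr0.
have mlt : measurable_fun setT (fun x => (f x < t)%R%:R : R).
  rewrite (_ : (fun x => _) = fun x => 1 - (\1_(`[t, +oo[) (f x) : R)).
    by apply: measurable_funB.
  apply/funext => x; rewrite indicE; have [ft|tf] := ltP (f x) t.
    by rewrite memNset ?subr0//= in_itv/= andbT; apply/negP; rewrite -ltNge.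
  by rewrite mem_set ?subrr//= in_itv/= andbT.
have mp (p : {poly R}) : measurable_fun setT (fun x => p.[f x]).
  under eq_fun do rewrite horner_coef.
  by apply: measurable_sum => i; apply: measurable_funM => //; exact: measurable_funX.
have p01 n x : 0 <= (threshold_poly (k%:R * t)^-1 k n).[f x] <= 1.
  apply: threshold_poly01; rewrite mulr_ge0 ?invr_ge0 ?(ltW kt0)//=.
  by rewrite mulrC ler_pdivrMr// mul1r.
apply: fine_cvg; rewrite fineK; last first.
  apply: (integrable_fin_num measurableT).
  apply: (bounded_integrable_prob (M := 1)) => // x.
  by case: ltP; rewrite ?normr1 ?normr0.
have [|||||_ _] := @dominated_convergence _ _ _ F setT measurableT
  (fun n x => ((threshold_poly (k%:R * t)^-1 k n).[f x])%:E)
  (fun x => ((f x < t)%R%:R : R)%:E) (cst 1%E); last exact.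
- by move=> n; apply/measurable_EFinP; exact: mp.
- exact/measurable_EFinP.
- apply: aeW => x _; apply: cvg_EFin; first exact: nearW.
  by apply: threshold_poly_cvg => //; rewrite f0 fk.
- by apply: (bounded_integrable_prob (M := 1)) => // x; rewrite normr1.
- apply: aeW => x n _ /=; rewrite lee_fin; have /andP[p0 p1] := p01 n x.
  by rewrite ger0_norm.
Qed.

End excess_mass.

Theorem theorem4p1 (R : realType) (d : nat) (S : sampling)
    (F G : probability (euclid R d) R) (f g : euclid R d -> R)
    (d_ge1 : (1 <= d)%N)
    (Ff : bounded_density F f) (Gg : bounded_density G g)
    (FG : forall L : R, 0 <= L -> eecc S F L = eecc S G L)
    (Fd : times_derivable_at0 d (eecc S F)) :
  forall t : R, 0 <= t -> excess_mass f t = excess_mass g t.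
Proof.
have moments j : density_moment F f j = density_moment G g j.
  apply/eqP; rewrite -subr_eq0; apply/eqP.
  apply: (mulfI (@eecc_coef_neq0 R d d_ge1 j)); rewrite mulr0.
  apply: (power_series_eq0 (c := fun j => eecc_coef d j *
    (density_moment F f j - density_moment G g j))) => L L0.
  have [cF eF] := eecc_series S Ff d_ge1 L0.
  have [cG eG] := eecc_series S Gg d_ge1 L0.
  have : series (fun j => eecc_coef d j * density_moment F f j * L ^+ j) J -
      series (fun j => eecc_coef d j * density_moment G g j * L ^+ j) J
      @[J --> \oo] --> (0 : R).
    rewrite [X in _ --> X](_ : _ = eecc S F L - eecc S G L); last first.
      by rewrite FG ?subrr// ltW.
    by rewrite eF eG; exact: cvgB.
  apply: cvg_trans; apply: near_eq_cvg; apply: nearW => J.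
  rewrite /series/= -sumrB; apply: eq_bigr => i _.
  by rewrite mulrBr mulrBl.
move=> t; rewrite le_eqVlt => /predU1P[<-|t0].
  by rewrite (excess_mass0 Ff) (excess_mass0 Gg).
have [_ f0 [Mf fM] _] := Ff; have [_ g0 [Mg gM] _] := Gg.
(* A single [k] serves for both densities, so that the same polynomials do. *)
pose k := (maxn (Num.truncn (Mf / t)) (Num.truncn (Mg / t))).+1.
have bound (h : euclid R d -> R) (M : R) : (forall x, h x <= M) ->
    (Num.truncn (M / t) < k)%N -> forall x, h x <= k%:R * t.
  move=> hM Mk x; apply: (le_trans (hM x)); rewrite -ler_pdivrMr//.
  apply: (le_trans (ltW (truncnS_gt _))); rewrite ler_nat//.
have fk := bound f Mf fM (leq_ltn_trans (leq_maxl _ _) (ltnSn _)).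
have gk := bound g Mg gM (leq_ltn_trans (leq_maxr _ _) (ltnSn _)).
have limF := excess_mass_limit Ff t0 (ltn0Sn _) fk.
have limG := excess_mass_limit Gg t0 (ltn0Sn _) gk.
apply: oppr_inj; apply: (addrI 1); apply: cvg_unique limF _ => //.
apply: cvg_trans limG; apply: near_eq_cvg; apply: nearW => n.
by rewrite (integral_poly Ff) (integral_poly Gg); apply: eq_bigr => i _; rewrite moments.
Qed.
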